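(* Let $k$ be a field, let $V$ be a finite-dimensional $k$-vector space, let $b\in V\otimes V$ be a nonzero element (a single homogeneous quadratic relation), and let $A=T(V)/(b)$ be the quotient of the tensor algebra $T(V)$ (graded with $V$ in degree $1$) by the two-sided ideal generated by $b$. Then $A$ is graded coherent.
   Context: A graded algebra is an $\mathbb N$-graded associative $k$-algebra $A=A_0\oplus A_1\oplus\cdots$ which is connected ($A_0=k$) and finitely generated. All modules are $\mathbb Z$-graded and all elements and maps are homogeneous. A finitely generated graded right $A$-module is called graded coherent if each of its finitely generated graded submodules is finitely presented (presented by finitely many generators and relations). The algebra $A$ is called graded coherent (meaning graded right coherent) if every finitely generated homogeneous right ideal of $A$ is finitely presented as a right $A$-module, i.e. $A$ is graded coherent as a right module over itself. *)

(* Defs.v *)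
From HB Require Import structures.
From mathcomp Require Import all_boot all_order all_algebra.
From mathcomp Require Import finmap boolp monalg.

Set Implicit Arguments.
Unset Strict Implicit.
Unset Printing Implicit Defensive.

Import GRing.Theory.

Local Open Scope ring_scope.
Local Open Scope quotient_scope.

(* An N-graded, connected, finitely generated associative k-algebra.  The     *)
(* third and fourth axioms say that A is the direct sum of its components,    *)
(* and the last one that A is generated by s as a k-algebra.                  *)
Record graded_algebra (k : fieldType) := GradedAlgebra {
  ga_sort :> algType k;
  ga_gr : nat -> ga_sort -> Prop;
  _ : forall d (c : k) x y, ga_gr d x -> ga_gr d y -> ga_gr d (c *: x + y);
  _ : forall d e x y, ga_gr d x -> ga_gr e y -> ga_gr (d + e)%N (x * y);
  _ : forall x, exists n (y : nat -> ga_sort),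
      (forall d, ga_gr d (y d)) /\ x = \sum_(d < n) y d;
  _ : forall n (y : nat -> ga_sort),
      (forall d, ga_gr d (y d)) -> \sum_(d < n) y d = 0 ->
      forall d, (d < n)%N -> y d = 0;
  _ : forall x, ga_gr 0 x <-> exists c : k, x = c%:A;
  _ : exists s : seq ga_sort, forall P : ga_sort -> Prop,
      (forall x, x \in s -> P x) -> P 1 ->
      (forall (c : k) x y, P x -> P y -> P (c *: x + y)) ->
      (forall x y, P x -> P y -> P (x * y)) -> forall x, P x
}.

(* A Z-grading on A, zero in negative degrees.                                *)
Definition zgr (k : fieldType) (A : graded_algebra k) (z : int) (a : A) : Prop :=
  match z with Posz d => ga_gr d a | Negz _ => a = 0 end.

(* Right A-modules are left modules over the converse ring A^c, so that       *)
(* a *: x stands for x.a.  In particular (A^c)^o is A as a right module over  *)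
(* itself (a *: x is the product x * a of A), and {ffun 'I_m -> (A^c)^o} is   *)
(* the free right module of rank m.                                           *)
Section RightModules.
Variables (k : fieldType) (A : graded_algebra k).

Definition spans (M : lmodType A^c) m (g : 'I_m -> M) (N : M -> Prop) : Prop :=
  forall x, N x <-> exists c : 'I_m -> A^c, x = \sum_i c i *: g i.

Definition syzygy (M : lmodType A^c) m (g : 'I_m -> M) :
    {ffun 'I_m -> (A^c)^o} -> Prop :=
  fun c => \sum_i (c i : A^c) *: g i = 0.

Variables (M : lmodType A^c) (gr : int -> M -> Prop).

Definition fin_generated (N : M -> Prop) : Prop :=
  exists m (g : 'I_m -> M), spans g N.

Definition graded_sub (N : M -> Prop) : Prop :=
  forall x, N x -> exists m (d : 'I_m -> int) (y : 'I_m -> M),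
    (forall i, gr (d i) (y i) /\ N (y i)) /\ x = \sum_i y i.

(* The generator g i has degree d i and the relation r j has degree e j, i.e. *)
(* its i-th coordinate lies in A(- d i) in degree e j.                        *)
Definition fin_presented (N : M -> Prop) : Prop :=
  exists m (g : 'I_m -> M) (d : 'I_m -> int)
         p (r : 'I_p -> {ffun 'I_m -> (A^c)^o}) (e : 'I_p -> int),
    [/\ forall i, gr (d i) (g i),
        spans g N,
        forall j i, zgr (e j - d i) (r j i : A)
      & spans r (syzygy g)].

End RightModules.

Definition regular_right (k : fieldType) (A : graded_algebra k) : lmodType A^c :=
  (A^c)^o.

(* The hypothesis fin_generated I already forces I to be a right ideal.       *)
Definition graded_coherent (k : fieldType) (A : graded_algebra k) : Prop :=
  forall I : regular_right A -> Prop,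
    graded_sub (M := regular_right A) (@zgr k A) I -> fin_generated I ->
    fin_presented (M := regular_right A) (@zgr k A) I.

Definition ideal_gen (R : nzRingType) (b x : R) : Prop :=
  exists n (u v : 'I_n -> R), x = \sum_i u i * b * v i.

Section IdealGen.
Variables (R : nzRingType) (b : R).

Definition ideal_pred : {pred R} := fun x => `[< ideal_gen b x >].

Lemma ideal_predP x : reflect (ideal_gen b x) (x \in ideal_pred).
Proof. exact: asboolP. Qed.

Lemma ideal_gen0 : ideal_gen b 0.
Proof. by exists 0%N, (fun=> 0), (fun=> 0); rewrite big_ord0. Qed.

Lemma ideal_genD x y : ideal_gen b x -> ideal_gen b y -> ideal_gen b (x + y).
Proof.
move=> [n [u [v ->]]] [m [u' [v' ->]]].
pose glue T (f : 'I_n -> T) (f' : 'I_m -> T) i :=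
  match split i with inl j => f j | inr j => f' j end.
exists (n + m)%N, (glue R u u'), (glue R v v'); rewrite big_split_ord /=.
congr (_ + _); apply: eq_bigr => i _; rewrite /glue.
  by rewrite (unsplitK (inl i)).
by rewrite (unsplitK (inr i)).
Qed.

Lemma ideal_genMl a x : ideal_gen b x -> ideal_gen b (a * x).
Proof.
move=> [n [u [v ->]]]; exists n, (fun i => a * u i), v.
by rewrite mulr_sumr; apply: eq_bigr => i _; rewrite !mulrA.
Qed.

Lemma ideal_genMr a x : ideal_gen b x -> ideal_gen b (x * a).
Proof.
move=> [n [u [v ->]]]; exists n, u, (fun i => v i * a).
by rewrite mulr_suml; apply: eq_bigr => i _; rewrite !mulrA.
Qed.

Lemma ideal_gen_sum (J : Type) (r : seq J) (P : pred J) (F : J -> R) :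
  (forall j, P j -> ideal_gen b (F j)) -> ideal_gen b (\sum_(j <- r | P j) F j).
Proof.
move=> h; apply: (big_ind (ideal_gen b)) => //; first exact: ideal_gen0.
exact: ideal_genD.
Qed.

Fact ideal_pred_zmod : zmod_closed ideal_pred.
Proof.
split=> [|x y /ideal_predP hx /ideal_predP hy]; apply/ideal_predP.
  exact: ideal_gen0.
by apply: ideal_genD => //; rewrite -mulN1r; apply: ideal_genMl.
Qed.

HB.instance Definition _ := GRing.isZmodClosed.Build R ideal_pred ideal_pred_zmod.
End IdealGen.

(* The quotient of a k-algebra T by the two-sided ideal generated by b; the   *)
(* properness of the ideal makes it a nonzero ring, as algType requires.      *)
Definition alg_quot (k : fieldType) (T : algType k) (b : T)
  (b_proper : ~ ideal_gen b 1) : Type := Quotient.quot (ideal_pred b).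

Section AlgQuot.
Variables (k : fieldType) (T : algType k) (b : T) (b_proper : ~ ideal_gen b 1).
Local Notation Q := (alg_quot b_proper).

HB.instance Definition _ := GRing.Zmodule.on Q.

Definition alg_quot_pi (x : T) : Q := \pi_(Quotient.quot (ideal_pred b)) x.
Definition alg_quot_repr (q : Q) : T := repr (q : Quotient.quot (ideal_pred b)).
Local Notation pi := alg_quot_pi.
Local Notation rep := alg_quot_repr.

Lemma alg_quot_reprK : cancel rep pi.
Proof. by move=> q; rewrite /pi /rep reprK. Qed.

Lemma alg_quot_piP x y : pi x = pi y <-> ideal_gen b (x - y).
Proof.
have E := Quotient.idealrBE (ideal_pred b) x y.
by split=> [h|/ideal_predP]; [apply/ideal_predP; rewrite E; apply/eqP|
  rewrite E => /eqP].
Qed.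

Fact alg_quot_pi_zmod : zmod_morphism pi.
Proof. by move=> x y; exact: (raddfB (\pi_(Quotient.quot (ideal_pred b)))). Qed.
HB.instance Definition _ := GRing.isZmodMorphism.Build T Q pi alg_quot_pi_zmod.

Definition alg_quot_mul (p q : Q) : Q := pi (rep p * rep q).

Lemma alg_quot_piM x y : pi (x * y) = alg_quot_mul (pi x) (pi y).
Proof.
apply/alg_quot_piP.
have hx : ideal_gen b (x - rep (pi x)).
  by apply/alg_quot_piP; rewrite alg_quot_reprK.
have hy : ideal_gen b (y - rep (pi y)).
  by apply/alg_quot_piP; rewrite alg_quot_reprK.
rewrite -[x * y](addrNK (rep (pi x) * y)) -addrA -mulrBl -mulrBr.
by apply: ideal_genD; [apply: ideal_genMr | apply: ideal_genMl].
Qed.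

Fact alg_quot_mulA : associative alg_quot_mul.
Proof.
move=> x y z; rewrite -[x]alg_quot_reprK -[y]alg_quot_reprK -[z]alg_quot_reprK.
by rewrite -!alg_quot_piM mulrA.
Qed.
Fact alg_quot_mul1 : left_id (pi 1) alg_quot_mul.
Proof. by move=> x; rewrite -[x]alg_quot_reprK -alg_quot_piM mul1r. Qed.
Fact alg_quot_mulr1 : right_id (pi 1) alg_quot_mul.
Proof. by move=> x; rewrite -[x]alg_quot_reprK -alg_quot_piM mulr1. Qed.
Fact alg_quot_mulDl : left_distributive alg_quot_mul +%R.
Proof.
move=> x y z; rewrite -[x]alg_quot_reprK -[y]alg_quot_reprK -[z]alg_quot_reprK.
by rewrite -raddfD -!alg_quot_piM -raddfD mulrDl.
Qed.
Fact alg_quot_mulDr : right_distributive alg_quot_mul +%R.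
Proof.
move=> x y z; rewrite -[x]alg_quot_reprK -[y]alg_quot_reprK -[z]alg_quot_reprK.
by rewrite -raddfD -!alg_quot_piM -raddfD mulrDr.
Qed.
Fact alg_quot_one_neq0 : pi 1 != 0.
Proof.
apply/eqP; rewrite -(raddf0 pi) => /alg_quot_piP; rewrite subr0.
exact: b_proper.
Qed.
HB.instance Definition _ := GRing.Zmodule_isNzRing.Build Q
  alg_quot_mulA alg_quot_mul1 alg_quot_mulr1 alg_quot_mulDl alg_quot_mulDr
  alg_quot_one_neq0.

Definition alg_quot_scale (c : k) (q : Q) : Q := pi (c *: rep q).

Lemma alg_quot_piZ c x : pi (c *: x) = alg_quot_scale c (pi x).
Proof.
apply/alg_quot_piP; rewrite -scalerBr -mulr_algl; apply: ideal_genMl.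
by apply/alg_quot_piP; rewrite alg_quot_reprK.
Qed.

Fact alg_quot_scaleA c d q :
  alg_quot_scale c (alg_quot_scale d q) = alg_quot_scale (c * d) q.
Proof. by rewrite -[q]alg_quot_reprK -!alg_quot_piZ scalerA. Qed.
Fact alg_quot_scale1 : left_id 1 alg_quot_scale.
Proof. by move=> q; rewrite -[q]alg_quot_reprK -!alg_quot_piZ scale1r. Qed.
Fact alg_quot_scaleDr : right_distributive alg_quot_scale +%R.
Proof.
move=> c p q; rewrite -[p]alg_quot_reprK -[q]alg_quot_reprK.
by rewrite -raddfD -!alg_quot_piZ -raddfD scalerDr.
Qed.
Fact alg_quot_scaleDl q : {morph alg_quot_scale^~ q : c d / c + d}.
Proof.
by move=> c d; rewrite -[q]alg_quot_reprK -!alg_quot_piZ -raddfD scalerDl.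
Qed.
HB.instance Definition _ := GRing.Zmodule_isLmodule.Build k Q
  alg_quot_scaleA alg_quot_scale1 alg_quot_scaleDr alg_quot_scaleDl.

Fact alg_quot_pi_monoid : monoid_morphism pi.
Proof. by split=> // x y; rewrite alg_quot_piM. Qed.
HB.instance Definition _ := GRing.isMonoidMorphism.Build T Q pi alg_quot_pi_monoid.

Fact alg_quot_pi_scalable : scalable pi.
Proof. by move=> c x; rewrite alg_quot_piZ. Qed.
HB.instance Definition _ := GRing.isScalable.Build k T Q *:%R pi alg_quot_pi_scalable.

Fact alg_quot_scalerAl (c : k) (x y : Q) : c *: (x * y) = (c *: x) * y.
Proof.
rewrite -[x]alg_quot_reprK -[y]alg_quot_reprK.
by rewrite -rmorphM -!linearZ /= -rmorphM scalerAl.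
Qed.
HB.instance Definition _ := GRing.Lmodule_isLalgebra.Build k Q alg_quot_scalerAl.

Fact alg_quot_scalerAr (c : k) (x y : Q) : c *: (x * y) = x * (c *: y).
Proof.
rewrite -[x]alg_quot_reprK -[y]alg_quot_reprK.
by rewrite -rmorphM -!linearZ /= -rmorphM scalerAr.
Qed.
HB.instance Definition _ := GRing.Lalgebra_isAlgebra.Build k Q alg_quot_scalerAr.

End AlgQuot.

(* T(V), as the free associative algebra on the chosen basis of V: its        *)
(* elements are the finitely supported functions from words to k.  It is      *)
(* characterised by tensor_alg_lift below.                                    *)
Definition tensor_alg (k : fieldType) (V : vectType k) : Type :=
  {malg k[{fmonom 'I_(\dim {:V})}]}.

Section TensorAlgebra.
Variables (k : fieldType) (V : vectType k).
Local Notation I := 'I_(\dim {:V}).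
Local Notation T := (tensor_alg V).

HB.instance Definition _ := GRing.Lalgebra.on T.

Fact tensor_alg_scalerAr (c : k) (x y : T) : c *: (x * y) = x * (c *: y).
Proof.
rewrite [x]monalgE mulr_suml mulr_suml scaler_sumr; apply: eq_bigr => m _.
rewrite -2!mul_malgC mulrA mulrA; congr (_ * y).
by rewrite !malgM_def !fgmulUU mul1m mulm1 mulrC.
Qed.
HB.instance Definition _ := GRing.Lalgebra_isAlgebra.Build k T tensor_alg_scalerAr.

Definition tensor_var (i : I) : T := << fmu i >>.

Definition tensor_inj (v : V) : T :=
  \sum_i coord (vbasis {:V}) i v *: tensor_var i.

Definition tensor_gr (d : nat) (x : T) : Prop :=
  forall m : {fmonom I}, x@_m != 0 -> fdeg m = d.

Lemma tensor_word (s : seq I) : << FMonom s >> = \prod_(i <- s) tensor_var i :> T.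
Proof.
elim: s => [|i s IH]; first by rewrite big_nil -fmoneE.
rewrite big_cons -IH malgM_def fgmulUU mul1r.
by congr mkmalgU; apply/val_inj; rewrite /= fmM fmU.
Qed.

Lemma tensor_ind (P : T -> Prop) :
  (forall i, P (tensor_var i)) -> P 1 ->
  (forall (c : k) x y, P x -> P y -> P (c *: x + y)) ->
  (forall x y, P x -> P y -> P (x * y)) -> forall x, P x.
Proof.
move=> hv h1 hl hm x.
have h0 : P 0 by have := hl (-1) _ _ h1 h1; rewrite scaleN1r addNr.
rewrite [x]monalgE; elim/big_ind: _ => // [y z hy hz|m _].
  by have := hl 1 _ _ hy hz; rewrite scale1r.
have -> : << x@_m *g m >> = x@_m *: << m >> + 0 :> T.
  by rewrite addr0 -mul_malgC malgM_def fgmulUU mulr1 mul1m.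
apply: hl => //; case: m => s; rewrite tensor_word.
by elim/big_ind: _ => // i _; apply: hv.
Qed.

Lemma tensor_inj_basis (i : I) : tensor_inj (vbasis {:V})`_i = tensor_var i.
Proof.
rewrite /tensor_inj (bigD1 i) //= big1 ?addr0 => [|j ji].
  by rewrite coord_free ?eqxx ?scale1r // (basis_free (vbasisP _)).
by rewrite coord_free ?(basis_free (vbasisP _)) // eq_sym (negPf ji) scale0r.
Qed.

Fact tensor_inj_linear : linear tensor_inj.
Proof.
move=> c u v; rewrite /tensor_inj scaler_sumr -big_split /=.
by apply: eq_bigr => i _; rewrite linearP scalerDl scalerA.
Qed.
HB.instance Definition _ := GRing.isLinear.Build k V T *:%R tensor_inj
  tensor_inj_linear.

Lemma tensor_alg_lift (B : algType k) (f : {linear V -> B}) :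
  exists g : {lrmorphism T -> B}, (forall v, g (tensor_inj v) = f v) /\
    forall g' : {lrmorphism T -> B},
      (forall v, g' (tensor_inj v) = f v) -> g' =1 g.
Proof.
pose e (i : I) := (vbasis {:V})`_i.
pose h (m : {fmonom I}) : B := \prod_(i <- (m : seq I)) f (e i).
have hP : mmorphism h.
  by split=> [x y|]; rewrite /h ?fmM ?big_cat // fm1 big_nil.
pose hM : {mmorphism {fmonom I} -> B} :=
  HB.pack h (isMultiplicative.Build {fmonom I} B h hP).
pose g0 : T -> B := mmap (in_alg B) hM.
have g0B : zmod_morphism g0 by exact: mmap_is_additive.
have g0M : monoid_morphism g0.
  have [|M1 M2] := @commr_mmap_is_multiplicative _ _ _ (in_alg B) hM.
    by move=> g m m'; rewrite /GRing.comm /= mulr_algl mulr_algr.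
  by split.
have g0Z : scalable g0.
  by move=> c x; rewrite /g0 mmapZ /= mulr_algl.
pose g : {lrmorphism T -> B} := HB.pack g0
  (GRing.isZmodMorphism.Build T B g0 g0B)
  (GRing.isMonoidMorphism.Build T B g0 g0M)
  (GRing.isScalable.Build k T B *:%R g0 g0Z).
have gv i : g (tensor_var i) = f (e i).
  by rewrite /= /g0 mmapU /= scale1r mul1r /h fmU big_seq1.
have injE v : g (tensor_inj v) = f v.
  rewrite linear_sum [in RHS](coord_vbasis (memvf v)) linear_sum.
  by apply: eq_bigr => i _; rewrite !linearZ; congr (_ *: _); apply: gv.
exists g; split=> // g' g'E.
apply: tensor_ind => [i||c x y hx hy|x y hx hy].
- by rewrite -tensor_inj_basis g'E injE.
- by rewrite !rmorph1.
- by rewrite !linearP; congr (_ *: _ + _); [apply: hx | apply: hy].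
- by rewrite !rmorphM; congr (_ * _); [apply: hx | apply: hy].
Qed.

Definition tensor_proj (d : nat) (x : T) : T :=
  \sum_(m <- msupp x | fdeg m == d) << x@_m *g m >>.

Lemma mcoeff_tensor_proj d (x : T) m :
  (tensor_proj d x)@_m = if fdeg m == d then x@_m else 0.
Proof.
rewrite /tensor_proj raddf_sum /=.
have [dm|dm] := boolP (fdeg m == d); last first.
  apply: big1 => m' dm'; rewrite mcoeffU; case: eqP => // E.
  by rewrite E (negPf dm) in dm'.
rewrite [in RHS](monalgE x) raddf_sum /= [in RHS](bigID (fun m => fdeg m == d)) /=.
rewrite [X in _ = _ + X]big1 ?addr0 // => m' dm'; rewrite mcoeffU.
by case: eqP => // E; rewrite E dm in dm'.
Qed.

Fact tensor_proj_zmod d : zmod_morphism (tensor_proj d).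
Proof.
move=> x y; apply/malgP => m; rewrite mcoeffB !mcoeff_tensor_proj mcoeffB.
by case: ifP; rewrite ?subr0.
Qed.
HB.instance Definition _ d :=
  GRing.isZmodMorphism.Build T T (tensor_proj d) (tensor_proj_zmod d).

Lemma tensor_proj_gr d x : tensor_gr d (tensor_proj d x).
Proof. by move=> m; rewrite mcoeff_tensor_proj; case: (fdeg m =P d) => // _ /eqP. Qed.

Lemma tensor_proj_id d e x :
  tensor_gr e x -> tensor_proj d x = if d == e then x else 0.
Proof.
move=> xe; apply/malgP => m; rewrite mcoeff_tensor_proj.
have [xm|xm] := eqVneq x@_m 0; first by rewrite xm if_same; case: ifP; rewrite ?mcoeff0 ?xm.
by rewrite (xe _ xm) eq_sym; case: ifP; rewrite ?mcoeff0.
Qed.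

Lemma tensor_proj_sum x : exists n, x = \sum_(d < n) tensor_proj d x.
Proof.
exists (\max_(m <- msupp x) fdeg m).+1; apply/malgP => m; rewrite raddf_sum /=.
have [xm|xm] := eqVneq x@_m 0.
  by rewrite big1 ?xm // => d _; rewrite mcoeff_tensor_proj xm if_same.
have lt_m : (fdeg m < (\max_(m <- msupp x) fdeg m).+1)%N.
  by rewrite ltnS; apply: leq_bigmax_seq; rewrite -?mcoeff_neq0.
rewrite (bigD1 (Ordinal lt_m)) //= mcoeff_tensor_proj eqxx big1 ?addr0 // => d.
rewrite mcoeff_tensor_proj -val_eqE /= eq_sym.
by case: eqP.
Qed.

Lemma tensor_grP d (c : k) x y :
  tensor_gr d x -> tensor_gr d y -> tensor_gr d (c *: x + y).
Proof.
move=> hx hy m; have [xm|/hx //] := eqVneq x@_m 0.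
by rewrite mcoeffD mcoeffZ xm mulr0 add0r; apply: hy.
Qed.

Lemma tensor_grM d e x y :
  tensor_gr d x -> tensor_gr e y -> tensor_gr (d + e)%N (x * y).
Proof.
move=> hx hy m; rewrite mcoeff_neq0 => /msuppM_le [m1 [m2 [h1 h2 ->]]].
by rewrite fdegM (hx m1) ?(hy m2) // mcoeff_neq0.
Qed.

Lemma tensor_gr0 x : tensor_gr 0 x <-> exists c : k, x = c%:A.
Proof.
split=> [hx|[c ->] m].
  exists x@_(mone : {fmonom I}); apply/malgP => m; rewrite mcoeffZ mcoeff1.
  have [->|m1] := eqVneq m mone; first by rewrite mulr1.
  rewrite mulr0; apply/eqP; apply: contraT => /hx /eqP.
  by rewrite fdeg_eq0 (negPf m1).
rewrite mcoeffZ mcoeff1; have [->|_] := eqVneq m mone; first by rewrite fdeg1.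
by rewrite mulr0 eqxx.
Qed.

Lemma tensor_gr_inj v : tensor_gr 1 (tensor_inj v).
Proof.
rewrite /tensor_inj; elim/big_ind: _ => [m|x y hx hy|i _ m].
- by rewrite mcoeff0 eqxx.
- by rewrite -[x]scale1r; apply: tensor_grP.
rewrite mcoeffZ mcoeffU1; have [<- _|_] := eqVneq (fmu i) m; first exact: fdegU.
by rewrite mulr0 eqxx.
Qed.

Lemma tensor_gr2P x : tensor_gr 2 x <->
  exists n (u v : 'I_n -> V), x = \sum_i tensor_inj (u i) * tensor_inj (v i).
Proof.
split=> [x2|[n [u [v ->]]]]; last first.
  elim/big_ind: _ => [m|y z hy hz|i _]; first by rewrite mcoeff0 eqxx.
    by rewrite -[y]scale1r; apply: tensor_grP.
  by apply: (@tensor_grM 1 1); apply: tensor_gr_inj.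
have [i0|noI] := pickP (@predT I); last first.
  exists 0%N, (fun=> 0), (fun=> 0); rewrite big_ord0; apply/malgP => m.
  rewrite mcoeff0; apply/eqP; apply: contraT => /x2.
  by case: m => -[|i s] //; have := noI i.
pose e (i : I) := (vbasis {:V})`_i.
pose s := enum_fset (msupp x); pose w (j : 'I_(size s)) := tnth (in_tuple s) j.
exists (size s), (fun j => x@_(w j) *: e (nth i0 (w j) 0)),
  (fun j => e (nth i0 (w j) 1)).
rewrite [LHS]monalgE big_tnth; apply: eq_bigr => j _.
rewrite linearZ /= !tensor_inj_basis -scalerAl -/(w j).
have : fdeg (w j) = 2 by apply: x2; rewrite mcoeff_neq0 /w mem_tnth.
case: (w j) => -[|a [|c [|? ?]]] //= _.
have := tensor_word [:: a; c]; rewrite 2!big_cons big_nil mulr1 => <-.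
by rewrite -mul_malgC malgM_def fgmulUU mulr1 mul1m.
Qed.

Lemma ideal_gen_proj d e (b x : T) :
  tensor_gr e b -> ideal_gen b x -> ideal_gen b (tensor_proj d x).
Proof.
move=> hb [n [u [v ->]]]; rewrite raddf_sum; apply: ideal_gen_sum => i _.
have [p uE] := tensor_proj_sum (u i); have [q vE] := tensor_proj_sum (v i).
have -> : u i * b * v i =
    \sum_(j < p) \sum_(l < q) tensor_proj j (u i) * b * tensor_proj l (v i).
  rewrite {1}uE -mulrA mulr_suml; apply: eq_bigr => j _.
  by rewrite mulrA {1}vE mulr_sumr.
rewrite raddf_sum; apply: ideal_gen_sum => j _.
rewrite raddf_sum; apply: ideal_gen_sum => l _.
rewrite /= (tensor_proj_id d (e := (j + e + l)%N)); last first.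
  by apply: tensor_grM; [apply: tensor_grM|] => //; apply: tensor_proj_gr.
case: ifP => _; last exact: ideal_gen0.
apply: ideal_genMr; apply: ideal_genMl.
by exists 1%N, (fun=> 1), (fun=> 1); rewrite big_ord1 mul1r mulr1.
Qed.

Lemma ideal_gen_proper e (b : T) :
  (0 < e)%N -> tensor_gr e b -> ~ ideal_gen b 1.
Proof.
move=> e0 hb [n [u [v]]] /(congr1 (mcoeff (mone : {fmonom I}))).
rewrite mcoeff1 eqxx raddf_sum /= big1 => [/eqP|i _]; first by rewrite oner_eq0.
rewrite !rmorphM /=; have [->|/hb h] := eqVneq b@_(mone : {fmonom I}) 0.
  by rewrite mulr0 mul0r.
by rewrite -h fdeg1 in e0.
Qed.

End TensorAlgebra.

(* V (x) V is identified with the degree-2 component of T(V), see tensor_gr2P.*)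
Section QuadraticAlgebra.
Variables (k : fieldType) (V : vectType k) (b : tensor_alg V).
Variable (b_quad : tensor_gr 2 b).
Local Notation T := (tensor_alg V).
Local Notation Q := (alg_quot (ideal_gen_proper (ltn0Sn 1) b_quad)).
Local Notation pi := (alg_quot_pi (ideal_gen_proper (ltn0Sn 1) b_quad)).

Definition one_relator_gr (d : nat) (q : Q) : Prop :=
  exists x, tensor_gr d x /\ q = pi x.

Fact one_relator_grP d (c : k) x y :
  one_relator_gr d x -> one_relator_gr d y -> one_relator_gr d (c *: x + y).
Proof.
move=> [x' [hx ->]] [y' [hy ->]]; exists (c *: x' + y'); rewrite linearP.
by split=> //; apply: tensor_grP.
Qed.

Fact one_relator_grM d e x y :
  one_relator_gr d x -> one_relator_gr e y -> one_relator_gr (d + e)%N (x * y).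
Proof.
move=> [x' [hx ->]] [y' [hy ->]]; exists (x' * y'); rewrite rmorphM.
by split=> //; apply: tensor_grM.
Qed.

Fact one_relator_gr_sum x : exists n (y : nat -> Q),
  (forall d, one_relator_gr d (y d)) /\ x = \sum_(d < n) y d.
Proof.
rewrite -[x]alg_quot_reprK; set t := alg_quot_repr x.
have [n tE] := tensor_proj_sum t; exists n, (fun d => pi (tensor_proj d t)).
split=> [d|]; first by exists (tensor_proj d t); split=> //; apply: tensor_proj_gr.
by rewrite {1}tE raddf_sum.
Qed.

Fact one_relator_gr_uniq n (y : nat -> Q) :
  (forall d, one_relator_gr d (y d)) -> \sum_(d < n) y d = 0 ->
  forall d, (d < n)%N -> y d = 0.
Proof.
move=> /choice [z hz] y0 d dn.
have -> : y d = pi (tensor_proj d (\sum_(i < n) z i)).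
  suff -> : tensor_proj d (\sum_(i < n) z i) = z d by rewrite (hz d).2.
  rewrite (raddf_sum (tensor_proj d)) (bigD1 (Ordinal dn)) //=.
  rewrite big1 => [|i ni]; first by rewrite (tensor_proj_id d (hz d).1) eqxx addr0.
  rewrite (tensor_proj_id d (hz i).1); case: eqP => // di.
  by rewrite -val_eqE /= -di eqxx in ni.
rewrite -(raddf0 pi); apply/alg_quot_piP; rewrite subr0.
apply: (ideal_gen_proj _ b_quad); rewrite -[X in ideal_gen _ X]subr0.
apply/(alg_quot_piP (ideal_gen_proper (ltn0Sn 1) b_quad)).
rewrite raddf_sum raddf0 -[RHS]y0; apply: eq_bigr => i _.
by rewrite (hz i).2.
Qed.

Fact one_relator_gr0 x : one_relator_gr 0 x <-> exists c : k, x = c%:A.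
Proof.
split=> [[y [/tensor_gr0 [c ->] ->]]|[c ->]].
  by exists c; rewrite linearZ rmorph1.
by exists c%:A; split; [apply/tensor_gr0; exists c | rewrite linearZ rmorph1].
Qed.

Fact one_relator_fg : exists s : seq Q, forall P : Q -> Prop,
  (forall x, x \in s -> P x) -> P 1 ->
  (forall (c : k) x y, P x -> P y -> P (c *: x + y)) ->
  (forall x y, P x -> P y -> P (x * y)) -> forall x, P x.
Proof.
exists [seq pi (tensor_var i) | i <- enum 'I_(\dim {:V})] => P hs h1 hl hm x.
rewrite -[x]alg_quot_reprK; elim/tensor_ind: (alg_quot_repr x) => [i||c y z|y z].
- by apply: hs; apply: map_f; rewrite mem_enum.
- by rewrite rmorph1.
- by rewrite linearP; apply: hl.
- by rewrite rmorphM; apply: hm.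
Qed.

Definition one_relator_alg : graded_algebra k :=
  GradedAlgebra one_relator_grP one_relator_grM one_relator_gr_sum
    one_relator_gr_uniq one_relator_gr0 one_relator_fg.

End QuadraticAlgebra.

(* Main.v *)
Require Import Defs.
From mathcomp Require Import all_boot all_order all_algebra.
From mathcomp Require Import finmap boolp monalg.

Set Implicit Arguments.
Unset Strict Implicit.
Unset Printing Implicit Defensive.

Import GRing.Theory.
Local Open Scope ring_scope.

(** Let [b = \sum_(i, j) beta i j x_i x_j].  A finitely generated graded right ideal
is the image of [f : \bigoplus_i A(- d i) -> A]; it suffices that the module [S] of
syzygies satisfies [S_(D+1) = S_D V] for [D] large.

Two facts on [A] are used: if [\sum_j a_j x_j = 0], then [a_j = q r_j] with
[r_j = \sum_i beta i j x_i]; and, unless [beta] is a multiple of the square of a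
linear form, there are functionals [g_1, g_2, ...] on [V] with
[beta (g_D, g_(D+1)) = 0] and [beta (_, g_D) <> 0].  Such a sequence is a point
module: a right module with basis [p_0, p_1, ...] and [p_(D-1) x = g_D(x) p_D].
Following the coordinates of a vector of total degree [D] into [p_D] gives a
linear map [eps_D] to a fixed space [k^m].  A syzygy of degree [D + 1] killed by
[eps_(D+1)] lies in [S_D V], by an induction on the degree which divides by the
linear forms [beta (_, g_(D+1))].  Moreover [eps_D (S_D)] increases with [D]: a
suitable element of [V] carries it into [eps_(D+1) (S_(D+1))].  As [k^m] has finite
dimension it becomes stationary, and from then on [S_(D+1) = S_D V].  When [b] is
a multiple of a square the same conclusion is a direct computation. *)

(** * Spans and subspaces *)

Section LinearSpan.
Variables (R : nzRingType) (M : lmodType R).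
Implicit Types (s : seq M) (x y : M) (P : M -> Prop).

Definition lin_span s x : Prop :=
  exists c : 'I_(size s) -> R, x = \sum_i c i *: s`_i.

Definition lin_closed P : Prop :=
  P 0 /\ forall (c : R) x y, P x -> P y -> P (c *: x + y).

Lemma lin_closed_sum P (J : Type) (r : seq J) (Q : pred J) (F : J -> M) :
  lin_closed P -> (forall j, Q j -> P (F j)) -> P (\sum_(j <- r | Q j) F j).
Proof.
move=> [P0 PD] PF; apply: (big_ind P) => // x y Px Py.
by rewrite -[x]scale1r; apply: PD.
Qed.

Lemma lin_closedZ P c x : lin_closed P -> P x -> P (c *: x).
Proof. by move=> [P0 PD] Px; rewrite -[_ *: _]addr0; apply: PD. Qed.

Lemma lin_closedB P x y : lin_closed P -> P x -> P y -> P (x - y).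
Proof. by move=> [P0 PD] Px Py; rewrite addrC -scaleN1r; apply: PD. Qed.

Lemma lin_closedD P x y : lin_closed P -> P x -> P y -> P (x + y).
Proof. by move=> [P0 PD] Px Py; rewrite -[x]scale1r; apply: PD. Qed.

Lemma lin_span_closed s : lin_closed (lin_span s).
Proof.
split=> [|c x y [u ->] [v ->]].
  by exists (fun=> 0); rewrite big1 // => i _; rewrite scale0r.
exists (fun i => c * u i + v i); rewrite scaler_sumr -big_split /=.
by apply: eq_bigr => i _; rewrite scalerDl scalerA.
Qed.

Lemma lin_span_cons y s x :
  lin_span (y :: s) x <-> exists c z, lin_span s z /\ x = c *: y + z.
Proof.
split=> [[c ->]|[c [z [[u ->] ->]]]].
  rewrite big_ord_recl; exists (c ord0), (\sum_i c (lift ord0 i) *: s`_i).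
  by split=> //; exists (fun i => c (lift ord0 i)).
exists (fun i => if unlift ord0 i is Some j then u j else c).
rewrite big_ord_recl unlift_none; congr (_ + _).
by apply: eq_bigr => i _; rewrite liftK.
Qed.

Lemma lin_span_mem s x : x \in s -> lin_span s x.
Proof.
elim: s => // y s IH; rewrite inE => /predU1P [->|/IH xs]; apply/lin_span_cons.
  by exists 1, 0; rewrite scale1r addr0; split=> //; have [] := lin_span_closed s.
by exists 0, x; rewrite scale0r add0r.
Qed.

Lemma lin_span_min P s x :
  lin_closed P -> (forall y, y \in s -> P y) -> lin_span s x -> P x.
Proof.
move=> Pl Ps [c ->]; apply: lin_closed_sum => // i _.
by apply: lin_closedZ => //; apply/Ps/mem_nth.
Qed.

Lemma lin_span_sub s1 s2 x : {subset s1 <= s2} -> lin_span s1 x -> lin_span s2 x.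
Proof.
move=> s12; apply: lin_span_min => [|y /s12]; first exact: lin_span_closed.
exact: lin_span_mem.
Qed.

End LinearSpan.

(** Elimination by induction on the list: an element of [P] that involves the head [y] serves as
    pivot and clears [y] from all the others, leaving elements of [P] in the span of the tail. *)
Lemma lin_span_subspace (k : fieldType) (M : lmodType k) (s : seq M) (P : M -> Prop) :
  lin_closed P -> (forall x, P x -> lin_span s x) ->
  exists s', (forall x, x \in s' -> P x) /\ forall x, P x -> lin_span s' x.
Proof.
elim: s P => [|y s IH] P Pl sP; first by exists [::].
have [|s' [Ps' s'P]] := IH (fun x => P x /\ lin_span s x) _ (fun x h => h.2).
  have [P0 PD] := Pl; have [s0 sD] := lin_span_closed s.
  by split=> // c x z [Px sx] [Pz sz]; split; [apply: PD | apply: sD].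
have [[p [c [z [[Pp sz] [pE c0]]]]]|no] := pselect (exists p c z,
    (P p /\ lin_span s z) /\ p = c *: y + z /\ c != 0).
  exists (p :: s'); split=> [x|x Px].
    by rewrite inE => /predU1P [->|/Ps' []].
  have /lin_span_cons [d [w [sw xE]]] := sP _ Px.
  apply/lin_span_cons; exists (d / c), (x - (d / c) *: p); split; last by rewrite addrC subrK.
  apply: s'P; split.
    by apply: lin_closedB => //; apply: lin_closedZ.
  rewrite xE pE scalerDr scalerA divfK // opprD addrACA subrr add0r.
  apply: lin_closedB => //; first exact: lin_span_closed.
  by apply: lin_closedZ => //; exact: lin_span_closed.
exists s'; split=> [x /Ps' []//|x Px]; apply: s'P; split=> //.
have /lin_span_cons [d [w [sw xE]]] := sP _ Px.
have [d0|d0] := eqVneq d 0; first by rewrite xE d0 scale0r add0r.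
by case: no; exists x, d, w.
Qed.

Lemma functional0 (k : fieldType) (U : lmodType k) (h : U -> k) :
  (forall c x y, h (c *: x + y) = c * h x + h y) -> h 0 = 0.
Proof. by move=> /(_ (-1) 0 0); rewrite scaler0 addr0 mulN1r addNr. Qed.

Lemma functionalD (k : fieldType) (U : lmodType k) (h : U -> k) :
  (forall c x y, h (c *: x + y) = c * h x + h y) -> {morph h : x y / x + y}.
Proof. by move=> hP x y; rewrite -[x]scale1r hP mul1r scale1r. Qed.

(** * Syzygies over an algebra with one quadratic relation *)

Lemma subz1_succ (D : nat) : D.+1%:Z - 1 = D%:Z.
Proof. by rewrite -addn1 PoszD addrK. Qed.

Section GradedAlgebra.
Variables (k : fieldType) (A : graded_algebra k).
Implicit Types (x y : A).

Lemma ga_grP d (c : k) x y : ga_gr d x -> ga_gr d y -> ga_gr d (c *: x + y).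
Proof. by case: A x y => ? ? h *; apply h. Qed.

Lemma ga_grM d e x y : ga_gr d x -> ga_gr e y -> ga_gr (d + e)%N (x * y).
Proof. by case: A x y => ? ? ? h *; apply h. Qed.

Lemma ga_gr_sum x : exists n (y : nat -> A),
  (forall d, ga_gr d (y d)) /\ x = \sum_(d < n) y d.
Proof. by case: A x => ? ? ? ? h *; apply h. Qed.

Lemma ga_gr_uniq n (y : nat -> A) : (forall d, ga_gr d (y d)) ->
  \sum_(d < n) y d = 0 -> forall d, (d < n)%N -> y d = 0.
Proof. by case: A y => ? ? ? ? ? h *; apply (h n). Qed.

Lemma ga_gr0P x : ga_gr 0 x <-> exists c : k, x = c%:A.
Proof. by case: A x => ? ? ? ? ? ? h *; apply h. Qed.

Lemma ga_gr_lin d : lin_closed (M := A) (ga_gr d).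
Proof.
split=> [|c x y]; last exact: ga_grP.
have [n [y [/(_ d) yd _]]] := ga_gr_sum 0.
by rewrite -[0](addNr (y d)) -scaleN1r; apply: ga_grP.
Qed.

Lemma zgr_lin z : lin_closed (M := A) (zgr z).
Proof.
case: z => d /=; first exact: ga_gr_lin.
by split=> // c x y -> ->; rewrite scaler0 addr0.
Qed.

Lemma zgrM z w x y : zgr z x -> zgr w y -> zgr (z + w) (x * y).
Proof.
have z0 v : zgr v (0 : A) by have [] := zgr_lin v.
case: z => d; last by move=> /= -> _; rewrite mul0r.
case: w => e; last by move=> _ /= ->; rewrite mulr0.
exact: ga_grM.
Qed.

End GradedAlgebra.

Section Syzygies.
Variables (k : fieldType) (A : graded_algebra k) (n : nat) (X : 'I_n -> A).
Variable beta : 'M[k]_n.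

Definition lsupp (j : 'I_n) : A := \sum_i beta i j *: X i.

(* [X] generates [A], and the left module [A_+] has the presentation with     *)
(* generators [X j] and the single relation [\sum_j lsupp j * X j = 0].       *)
Record one_relator_presentation : Prop := OneRelatorPresentation {
  orp_gen : forall d a, ga_gr d.+1 a ->
    exists c : 'I_n -> A, (forall j, ga_gr d (c j)) /\ a = \sum_j c j * X j;
  orp_var : forall j, ga_gr 1 (X j);
  orp_rel : \sum_j lsupp j * X j = 0;
  orp_exact : forall z (a : 'I_n -> A), (forall j, zgr z (a j)) ->
    \sum_j a j * X j = 0 ->
    exists q, zgr (z - 1) q /\ forall j, a j = q * lsupp j
}.

Hypothesis pres : one_relator_presentation.
Variables (m : nat) (f : 'I_m -> A) (d : 'I_m -> nat).
Hypothesis f_gr : forall i, ga_gr (d i) (f i).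
Local Notation vec := {ffun 'I_m -> A}.
Implicit Types (c s t : vec) (a q : A).

Definition rmul c a : vec := [ffun i => c i * a].
Definition ev c : A := \sum_i f i * c i.
Definition hvec (z : int) c : Prop := forall i, zgr (z - (d i)%:Z) (c i).
Definition hsyz (z : int) c : Prop := hvec z c /\ ev c = 0.

Lemma evP (e : k) c s : ev (e *: c + s) = e *: ev c + ev s.
Proof.
rewrite /ev scaler_sumr -big_split /=; apply: eq_bigr => i _.
by rewrite !ffunE mulrDr scalerAr.
Qed.

Lemma ev0 : ev 0 = 0.
Proof. by rewrite /ev big1 // => i _; rewrite ffunE mulr0. Qed.

Lemma evZ (e : k) c : ev (e *: c) = e *: ev c.
Proof. by rewrite -[e *: c]addr0 evP ev0 addr0. Qed.

Lemma evD c s : ev (c + s) = ev c + ev s.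
Proof. by rewrite -[c]scale1r evP !scale1r. Qed.

Lemma evB c s : ev (c - s) = ev c - ev s.
Proof. by rewrite evD -scaleN1r evZ scaleN1r. Qed.

Lemma ev_sum (J : Type) (r : seq J) (F : J -> vec) :
  ev (\sum_(j <- r) F j) = \sum_(j <- r) ev (F j).
Proof. exact: (big_morph ev evD ev0). Qed.

Lemma ev_rmul c a : ev (rmul c a) = ev c * a.
Proof. by rewrite /ev mulr_suml; apply: eq_bigr => i _; rewrite ffunE mulrA. Qed.

Lemma rmulA c a q : rmul (rmul c a) q = rmul c (a * q).
Proof. by apply/ffunP => i; rewrite !ffunE mulrA. Qed.

Lemma rmulDl c s a : rmul (c + s) a = rmul c a + rmul s a.
Proof. by apply/ffunP => i; rewrite !ffunE mulrDl. Qed.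

Lemma rmulBl c s a : rmul (c - s) a = rmul c a - rmul s a.
Proof. by apply/ffunP => i; rewrite !ffunE mulrBl. Qed.

Lemma rmulZl (e : k) c a : rmul (e *: c) a = rmul c (e *: a).
Proof. by apply/ffunP => i; rewrite !ffunE -scalerAl scalerAr. Qed.

Lemma rmulZr (e : k) c a : rmul c (e *: a) = e *: rmul c a.
Proof. by apply/ffunP => i; rewrite !ffunE scalerAr. Qed.

Lemma rmul_sumr (J : Type) (r : seq J) (F : J -> A) c :
  rmul c (\sum_(j <- r) F j) = \sum_(j <- r) rmul c (F j).
Proof.
apply: (big_morph (rmul c)) => [a q|]; apply/ffunP => i; rewrite !ffunE.
  by rewrite mulrDr.
by rewrite mulr0.
Qed.

Lemma hvec_lin z : lin_closed (M := vec) (hvec z).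
Proof.
split=> [i|e c s hc hs i]; rewrite !ffunE; have [h0 hD] := zgr_lin A (z - (d i)%:Z) => //.
exact: hD.
Qed.

Lemma hsyz_lin z : lin_closed (M := vec) (hsyz z).
Proof.
have [h0 hD] := hvec_lin z; split=> [|e c s [hc c0] [hs s0]]; first by split=> //; exact: ev0.
by split; [exact: hD | rewrite evP c0 s0 scaler0 addr0].
Qed.

Lemma hvec_rmul z w c a : hvec z c -> zgr w a -> hvec (z + w) (rmul c a).
Proof. by move=> hc ha i; rewrite ffunE addrAC; apply: zgrM. Qed.

Lemma zgr_ev z c : hvec z c -> zgr z (ev c).
Proof.
move=> hc; rewrite /ev; apply: (lin_closed_sum _ (zgr_lin A _)) => i _.
have -> : z = (d i)%:Z + (z - (d i)%:Z) by rewrite addrC subrK.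
by apply: zgrM => //; apply: f_gr.
Qed.

Lemma zgr_lsupp j : zgr 1 (lsupp j).
Proof.
rewrite /lsupp; apply: (lin_closed_sum _ (zgr_lin A 1)) => i _.
by apply: (lin_closedZ _ (zgr_lin A 1)); apply: (orp_var pres).
Qed.

Lemma zgr_gen z a : zgr z a -> (z = 0 -> a = 0) ->
  exists c : 'I_n -> A, (forall j, zgr (z - 1) (c j)) /\ a = \sum_j c j * X j.
Proof.
have triv : a = 0 -> exists c : 'I_n -> A,
    (forall j, zgr (z - 1) (c j)) /\ a = \sum_j c j * X j.
  move=> ->; exists (fun=> 0); split=> [j|]; first by have [] := zgr_lin A (z - 1).
  by rewrite big1 // => j _; rewrite mul0r.
case: z triv => [[|e]|e] triv; [by move=> _ /(_ erefl) | | by move=> /= /triv].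
move=> /(orp_gen pres) [c [hc ->]] _; exists c.
by split=> // j; rewrite subz1_succ; apply: hc.
Qed.

(** Coordinates of positive degree lie in [A_+] and those of negative degree vanish, so only the
    coordinates with [z = d i], which are scalars, obstruct the decomposition. *)
Lemma hvec_gen z c : hvec z c -> (forall i, z = (d i)%:Z -> c i = 0) ->
  exists C : 'I_n -> vec, (forall j, hvec (z - 1) (C j)) /\
    c = \sum_j rmul (C j) (X j).
Proof.
move=> hc c0.
have /choice [C hC] i : exists C : 'I_n -> A,
    (forall j, zgr (z - (d i)%:Z - 1) (C j)) /\ c i = \sum_j C j * X j.
  by apply: zgr_gen => // /eqP; rewrite subr_eq0 => /eqP /c0.
exists (fun j => [ffun i => C i j]); split=> [j i|].
  by rewrite ffunE addrAC; apply: (hC i).1.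
apply/ffunP => i; rewrite sum_ffunE (hC i).2; apply: eq_bigr => j _.
by rewrite !ffunE.
Qed.

Lemma hsyz_exact z (C : 'I_n -> vec) : (forall j, hvec z (C j)) ->
  ev (\sum_j rmul (C j) (X j)) = 0 ->
  exists q, zgr (z - 1) q /\ forall j, ev (C j) = q * lsupp j.
Proof.
move=> hC e0; apply: (orp_exact pres) => [j|]; first exact: zgr_ev.
by rewrite -[RHS]e0 ev_sum; apply: eq_bigr => j _; rewrite ev_rmul.
Qed.

(* If [ev t = q], the multiples [rmul t (lsupp j)] can be subtracted from the *)
(* coefficients of [c] without changing [c], since they add up to [t] times   *)
(* the relation.                                                              *)
Lemma hsyz_correct z (C : 'I_n -> vec) q t : (forall j, hvec z (C j)) ->
    (forall j, ev (C j) = q * lsupp j) -> hvec (z - 1) t -> ev t = q ->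
  exists C', (forall j, hsyz z (C' j)) /\
    \sum_j rmul (C j) (X j) = \sum_j rmul (C' j) (X j).
Proof.
move=> hC eC ht et; exists (fun j => C j - rmul t (lsupp j)); split=> [j|].
  split; last by rewrite evB ev_rmul et eC subrr.
  apply: (lin_closedB (hvec_lin _)) => //.
  by rewrite -[z](subrK 1); apply: hvec_rmul => //; apply: zgr_lsupp.
under [RHS]eq_bigr => j _ do rewrite rmulBl rmulA.
rewrite sumrB -rmul_sumr (orp_rel pres) [X in _ - X](_ : _ = 0) ?subr0 //.
by apply/ffunP => i; rewrite !ffunE mulr0.
Qed.

(** * Syzygies in the presence of a point module *)

Section PointModule.
Variables (g : nat -> 'I_n -> k) (eps : nat -> A -> k).
Hypothesis g_rel : forall D, \sum_i \sum_j g D i * beta i j * g D.+1 j = 0.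
Hypothesis g_supp : forall D, exists i, \sum_j beta i j * g D.+1 j != 0.
Hypothesis epsP : forall D (e : k) x y, eps D (e *: x + y) = e * eps D x + eps D y.
Hypothesis eps1 : forall D, eps D 1 = 1.
Hypothesis epsX : forall D a j, eps D (a * X j) = g D j * eps D.-1 a.

(** Contracting the second factor of [b] with [g D] gives the linear form [beta (_, g_D)]: its
    coordinates are [mu D], and [u D] is its value in [A]. *)
Let mu D i : k := \sum_j beta i j * g D j.
Let u D : A := \sum_i mu D i *: X i.

Lemma u_lsupp D : u D = \sum_j g D j *: lsupp j.
Proof.
rewrite /u /lsupp; under [RHS]eq_bigr => j _ do rewrite scaler_sumr.
rewrite exchange_big; apply: eq_bigr => i _; rewrite scaler_suml.
by apply: eq_bigr => j _; rewrite scalerA mulrC.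
Qed.

Lemma g_mu D : \sum_j g D j * mu D.+1 j = 0.
Proof.
rewrite -[RHS](g_rel D); apply: eq_bigr => i _; rewrite mulr_sumr.
by apply: eq_bigr => j _; rewrite mulrA.
Qed.

Lemma eps0 D : eps D 0 = 0.
Proof. exact: functional0 (epsP D). Qed.

Lemma epsZ D (e : k) a : eps D (e *: a) = e * eps D a.
Proof. by rewrite -[e *: a]addr0 epsP eps0 addr0. Qed.

Lemma eps_sum D (J : Type) (r : seq J) (F : J -> A) :
  eps D (\sum_(j <- r) F j) = \sum_(j <- r) eps D (F j).
Proof. exact: (big_morph _ (functionalD (epsP D)) (eps0 D)). Qed.

Definition veps D c : {ffun 'I_m -> k^o} := [ffun i => eps D (c i)].

Lemma vepsP D (e : k) c s : veps D (e *: c + s) = e *: veps D c + veps D s.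
Proof. by apply/ffunP => i; rewrite !ffunE epsP. Qed.

(** A coordinate of degree 0 is a scalar, which [eps D] reads off unchanged; this removes the
    obstruction in [hvec_gen]. *)
Lemma veps_gen D c : hvec D%:Z c -> veps D c = 0 ->
  forall i, D%:Z = (d i)%:Z -> c i = 0.
Proof.
move=> hc /ffunP c0 i Di; have := hc i; rewrite Di subrr => /ga_gr0P [e ce].
by have := c0 i; rewrite !ffunE ce epsZ eps1 mulr1 => ->; rewrite scale0r.
Qed.

(** This is the rule [p_D x_j = g_(D+1)(x_j) p_(D+1)]; it singles out the combination of the [C j]
    on which the induction on the degree runs. *)
Lemma veps_comb D (C : 'I_n -> vec) :
  veps D.+1 (\sum_j rmul (C j) (X j)) = veps D (\sum_j g D.+1 j *: C j).
Proof.
apply/ffunP => i; rewrite !ffunE !sum_ffunE !eps_sum; apply: eq_bigr => j _.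
by rewrite !ffunE epsX epsZ.
Qed.

Lemma hvec_comb z (h : 'I_n -> k) (C : 'I_n -> vec) :
  (forall j, hvec z (C j)) -> hvec z (\sum_j h j *: C j).
Proof.
move=> hC; apply: (lin_closed_sum _ (hvec_lin _)) => j _.
by apply: (lin_closedZ _ (hvec_lin _)).
Qed.

Lemma ev_comb (h : 'I_n -> k) (C : 'I_n -> vec) (y : 'I_n -> A) :
  (forall j, ev (C j) = y j) -> ev (\sum_j h j *: C j) = \sum_j h j *: y j.
Proof. by move=> eC; rewrite ev_sum; apply: eq_bigr => j _; rewrite evZ eC. Qed.

(** After splitting [c] along the [X j], exactness expresses each [ev (C j)] by [q] and an element
    [p] of one degree less. By induction [p] is in the image of [ev], and a nonzero coefficient of
    [mu] then isolates [q]. *)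
Lemma ev_divide D c q : hvec D%:Z c -> veps D c = 0 -> zgr (D%:Z - 1) q ->
  ev c = q * u D.+1 -> exists t, hvec (D%:Z - 1) t /\ ev t = q.
Proof.
elim: D c q => [|D IH] c q hc c0 hq ec.
  (* Here [q] has degree -1, hence vanishes. *)
  exists 0; split; first by have [] := hvec_lin (0%:Z - 1).
  by rewrite ev0; move: hq.
have [C [hC cE]] := hvec_gen hc (veps_gen hc c0).
rewrite subz1_succ in hC hq *.
have [||p [hp pE]] := orp_exact pres (z := D%:Z) (a := fun j => ev (C j) - mu D.+2 j *: q).
- move=> j; apply: (lin_closedB (zgr_lin _ _)); first exact: zgr_ev.
  by apply: (lin_closedZ _ (zgr_lin A _)).
- under eq_bigr => j _ do rewrite mulrBl -ev_rmul -scalerAl scalerAr.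
  by rewrite sumrB -mulr_sumr -/(u D.+2) -ec cE ev_sum subrr.
have eC j : ev (C j) = p * lsupp j + mu D.+2 j *: q by rewrite -pE subrK.
(* Contraction with [g D.+1] kills the multiples of [q] by [g_mu] and leaves [p * u D.+1], the same
   situation one degree lower. *)
have [||||t [ht et]] := IH (\sum_j g D.+1 j *: C j) p.
- exact: hvec_comb.
- by rewrite -veps_comb -cE.
- exact: hp.
- rewrite (ev_comb _ eC); under eq_bigr => j _ do rewrite scalerDr scalerA scalerAr.
  by rewrite big_split /= -mulr_sumr -u_lsupp -scaler_suml g_mu scale0r addr0.
have [i mui] := g_supp D.+1; exists ((mu D.+2 i)^-1 *: (C i - rmul t (lsupp i))).
split; last by rewrite evZ evB ev_rmul et eC addrC addKr scalerA mulVf ?scale1r.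
apply: (lin_closedZ _ (hvec_lin _)).
apply: (lin_closedB (hvec_lin _)) => //.
by rewrite -[D%:Z](subrK 1); apply: hvec_rmul => //; apply: zgr_lsupp.
Qed.

(** The coefficients [C j] contracted with [g D.+1] have image [q * u D.+1] and zero [veps], so
    [ev_divide] supplies the [t] required by [hsyz_correct]. *)
Lemma hsyz_veps0 D s : hsyz D.+1%:Z s -> veps D.+1 s = 0 ->
  exists C : 'I_n -> vec, (forall j, hsyz D%:Z (C j)) /\ s = \sum_j rmul (C j) (X j).
Proof.
move=> [hs es] s0; have [C [hC sE]] := hvec_gen hs (veps_gen hs s0).
rewrite subz1_succ in hC.
have [|q [hq qE]] := hsyz_exact hC; first by rewrite -sE.
have [||||t [ht et]] := ev_divide (c := \sum_j g D.+1 j *: C j) (q := q) (D := D).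
- exact: hvec_comb.
- by rewrite -veps_comb -sE.
- exact: hq.
- rewrite (ev_comb _ qE) u_lsupp mulr_sumr.
  by apply: eq_bigr => j _; rewrite scalerAr.
by rewrite sE; apply: hsyz_correct ht et.
Qed.

Lemma g_neq0 D : exists j, g D.+1 j != 0.
Proof.
have [i /eqP mui] := g_supp D; have [//|no] := pselect (exists j, g D.+1 j != 0).
case: mui; rewrite big1 // => j _; have [->|gj] := eqVneq (g D.+1 j) 0.
  by rewrite mulr0.
by case: no; exists j.
Qed.

Definition hlead D (w : {ffun 'I_m -> k^o}) : Prop := exists s, hsyz D%:Z s /\ veps D s = w.

(** Right multiplication by [X j] scales [veps] by [g D.+1 j]; picking a nonzero value and dividing
    by it preserves [w]. The factor [s] is exposed so that the lift is visibly in [S_D V]. *)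
Lemma hlead_succ D w : hlead D w -> exists j e s,
  hsyz D%:Z s /\ hsyz D.+1%:Z (rmul s (e *: X j)) /\ veps D.+1 (rmul s (e *: X j)) = w.
Proof.
move=> [s [[hs es] <-]]; have [j gj] := g_neq0 D.
exists j, (g D.+1 j)^-1, s; split=> //; split.
  split; last by rewrite ev_rmul es mul0r.
  rewrite -addn1 PoszD; apply: hvec_rmul => //; apply: (lin_closedZ _ (zgr_lin A 1)).
  exact: (orp_var pres).
by apply/ffunP => i; rewrite !ffunE -scalerAr epsZ epsX mulrA mulVf ?mul1r.
Qed.

Lemma hlead_mono D E w : (D <= E)%N -> hlead D w -> hlead E w.
Proof.
move=> /subnK <-; elim: (E - D)%N => // e IH /IH /hlead_succ [j [c [s [_ [hs ws]]]]].
by exists (rmul s (c *: X j)).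
Qed.

(** The stages increase, so their union is a subspace of [k^m], spanned by finitely many vectors;
    the largest stage at which these occur will do. *)
Lemma hlead_stable : exists D0, forall D w, hlead D w -> hlead D0 w.
Proof.
pose delta i : {ffun 'I_m -> k^o} := [ffun j => (i == j)%:R].
have Ql : lin_closed (fun w => exists D, hlead D w).
  split=> [|c x y [D hD] [E hE]].
    exists 0%N, 0; split; first by have [] := hsyz_lin 0.
    by apply/ffunP => i; rewrite !ffunE eps0.
  exists (maxn D E).
  have [s [hs <-]] := hlead_mono (leq_maxl D E) hD.
  have [t [ht <-]] := hlead_mono (leq_maxr D E) hE.
  exists (c *: s + t); split; last exact: vepsP.
  by have [_] := hsyz_lin (maxn D E); apply.
have [|W [QW WQ]] := @lin_span_subspace _ _ [seq delta i | i <- enum 'I_m] _ Ql.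
  move=> w _; have -> : w = \sum_i w i *: delta i.
    apply/ffunP => i; rewrite sum_ffunE (bigD1 i) //= big1 => [|j ji].
      by rewrite !ffunE eqxx addr0 /GRing.scale /= mulr1.
    by rewrite !ffunE (negPf ji) scaler0.
  apply: lin_closed_sum => [|i _]; first exact: lin_span_closed.
  apply: (lin_closedZ _ (lin_span_closed _)).
  by apply/lin_span_mem/map_f; rewrite mem_enum.
have [D0 hD0] : exists D0, forall w, w \in W -> hlead D0 w.
  elim: W QW {WQ} => [|w W IH] QW; first by exists 0%N.
  have [D hD] := QW w (mem_head _ _).
  have [v vW|E hE] := IH; first by apply: QW; rewrite inE vW orbT.
  exists (maxn D E) => v; rewrite inE => /predU1P [->|/hE].
    exact: hlead_mono (leq_maxl _ _) hD.
  exact: hlead_mono (leq_maxr _ _).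
exists D0 => D w hw; have := WQ w (ex_intro _ D hw).
apply: lin_span_min => //; split=> [|c x y [s [hs <-]] [t [ht <-]]].
  exists 0; split; first by have [] := hsyz_lin D0.
  by apply/ffunP => i; rewrite !ffunE eps0.
exists (c *: s + t); split; last exact: vepsP.
by have [_] := hsyz_lin D0; apply.
Qed.

Lemma hsyz_gen_point : exists D0, forall D s, (D0 <= D)%N -> hsyz D.+1%:Z s ->
  exists C : 'I_n -> vec, (forall j, hsyz D%:Z (C j)) /\ s = \sum_j rmul (C j) (X j).
Proof.
have [D0 hD0] := hlead_stable; exists D0 => D s leD hs.
(* The vector [veps D.+1 s] already occurs at stage [D], hence is shared by a multiple of some [t]
   in [S_D]; the difference falls under [hsyz_veps0]. *)
have /(hlead_mono leD) /hlead_succ [j [e [t [ht [htX tE]]]]] : hlead D0 (veps D.+1 s).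
  by apply: (hD0 D.+1); exists s.
have [||C [hC sE]] := @hsyz_veps0 D (s - rmul t (e *: X j)).
- by apply: (lin_closedB (hsyz_lin _)).
- by rewrite addrC -scaleN1r vepsP tE scaleN1r addNr.
exists (fun i => C i + (if i == j then e *: t else 0)); split=> [i|].
  apply: (lin_closedD (hsyz_lin _)) => //.
  case: ifP => _; last by have [] := hsyz_lin D.
  by apply: (lin_closedZ _ (hsyz_lin _)).
under eq_bigr => i _ do rewrite rmulDl.
rewrite big_split /= -sE (bigD1 j) //= eqxx big1 => [|i /negPf ->].
  by rewrite addr0 rmulZl subrK.
by apply/ffunP => l; rewrite !ffunE mul0r.
Qed.

End PointModule.

(** * The case of a multiple of a square *)

Section Square.
Variables (e : k) (xi : 'I_n -> k) (j0 : 'I_n).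
Hypothesis e_neq0 : e != 0.
Hypothesis xi_neq0 : xi j0 != 0.
Hypothesis betaE : forall i j, beta i j = e * xi i * xi j.

Let x : A := \sum_i xi i *: X i.

Lemma lsupp_square j : lsupp j = (e * xi j) *: x.
Proof.
rewrite scaler_sumr; apply: eq_bigr => i _.
by rewrite betaE scalerA mulrAC.
Qed.

Lemma square_rel : x * x = 0.
Proof.
have := orp_rel pres; under eq_bigr => j _.
  rewrite lsupp_square -scalerA -scalerAl -scalerAl scalerAr; over.
by rewrite -scaler_sumr -mulr_sumr => /eqP; rewrite scaler_eq0 (negPf e_neq0) => /eqP.
Qed.

(** The coefficients satisfy [ev (C j) = (e * xi j) *: (q * x)], so they can be corrected by
    multiples of a vector with image [q * x] that right multiplication by [x] kills. A preimage [t0]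
    of [q * x] differs from a syzygy [t1] by a right multiple of [x]; as [x * x = 0], the vector
    [t0 - t1] is of this kind. *)
Lemma hsyz_gen_square : exists D0, forall D s, (D0 <= D)%N -> hsyz D.+1%:Z s ->
  exists C : 'I_n -> vec, (forall j, hsyz D%:Z (C j)) /\ s = \sum_j rmul (C j) (X j).
Proof.
(* Vectors of degrees [D.+3] and [D.+2] (after the shift of [D]) will be split along the [X j]; the
   threshold puts both degrees above all the [d i]. *)
exists (\max_i d i).+2 => -[|[|D]] s // leD [hs es].
have dD i : (d i < D.+1)%N.
  by apply: leq_ltn_trans (leD : (\max_i d i < D.+1)%N); apply: leq_bigmax.
have [|C [hC sE]] := hvec_gen hs.
  by move=> i [] Di; have := dD i; rewrite -Di ltnNge ltnW.
rewrite subz1_succ in hC.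
have [|q [hq qE]] := hsyz_exact hC; first by rewrite -sE.
have [t0 [ht0 et0]] : exists t, hvec D.+2%:Z t /\ ev t = q * x.
  exists ((e * xi j0)^-1 *: C j0); split; first by apply: (lin_closedZ _ (hvec_lin _)).
  rewrite evZ qE lsupp_square -scalerAr scalerA mulVf ?scale1r //.
  by rewrite mulf_neq0.
have [|T [hT tE]] := hvec_gen ht0.
  by move=> i [] Di; have := dD i; rewrite -Di ltnNge leqnSn.
rewrite subz1_succ in hT.
have [||p [hp pE]] := orp_exact pres (z := D.+1) (a := fun j => ev (T j) - xi j *: q).
- rewrite subz1_succ in hq => j; apply: (lin_closedB (zgr_lin _ _)); first exact: zgr_ev.
  by apply: (lin_closedZ _ (zgr_lin A _)).
- under eq_bigr => j _ do rewrite mulrBl -ev_rmul -scalerAl scalerAr.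
  by rewrite sumrB -mulr_sumr -/x -et0 tE ev_sum subrr.
(* All the [ev (T j)] are multiples of the one element [y], so subtracting multiples of [tau], whose
   image is [y], turns the [T j] into syzygies. *)
pose y := q + e *: (p * x).
have eT j : ev (T j) = xi j *: y.
  move/eqP: (pE j); rewrite subr_eq lsupp_square => /eqP ->.
  by rewrite scalerDr addrC scalerA -scalerAr mulrC.
pose tau := (xi j0)^-1 *: T j0.
pose T' j := T j - xi j *: tau.
have hT' j : hsyz D.+1%:Z (T' j).
  split.
    apply: (lin_closedB (hvec_lin _)) => //.
    apply: (lin_closedZ _ (hvec_lin _)).
    by apply: (lin_closedZ _ (hvec_lin _)).
  by rewrite evB !evZ !eT !scalerA divfK // subrr.
pose t1 := \sum_j rmul (T' j) (X j).
have tx : rmul t0 x = rmul t1 x.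
  have -> : t0 = t1 + rmul tau x.
    rewrite tE /t1; under eq_bigr => j _ do rewrite -[T j](subrK (xi j *: tau)) rmulDl rmulZl.
    by rewrite big_split /= -rmul_sumr.
  rewrite rmulDl rmulA square_rel [X in _ + X](_ : _ = 0) ?addr0 //.
  by apply/ffunP => i; rewrite !ffunE mulr0.
have ht1 : hsyz D.+2%:Z t1.
  apply: (lin_closed_sum _ (hsyz_lin _)) => j _.
  have [hTj eTj] := hT' j; split; last by rewrite ev_rmul eTj mul0r.
  by rewrite -[D.+2]addn1 PoszD; apply: hvec_rmul => //; apply: (orp_var pres).
exists (fun j => C j - (e * xi j) *: (t0 - t1)); split=> [j|].
  split; last first.
    by rewrite evB evZ evB et0 ht1.2 subr0 qE lsupp_square scalerAr subrr.
  apply: (lin_closedB (hvec_lin _)) => //.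
  apply: (lin_closedZ _ (hvec_lin _)).
  by apply: (lin_closedB (hvec_lin _)) => //; exact: ht1.1.
under eq_bigr => j _ do rewrite rmulBl rmulZl -scalerA.
rewrite sumrB -sE -rmul_sumr -scaler_sumr -/x rmulZr rmulBl tx subrr.
by rewrite scaler0 subr0.
Qed.
End Square.

End Syzygies.

(** * Existence of point modules *)

Section Dichotomy.
Variables (k : fieldType) (n : nat).
Implicit Types (a r w : 'I_n -> k).

(** If [r j0] is nonzero, each basis vector corrected by a multiple of the [j0]-th one is killed by
    [r], and testing [a] on it gives the factor [a j0 / r j0]. *)
Lemma functional_factor r a :
    (forall w, \sum_j r j * w j = 0 -> \sum_j a j * w j = 0) ->
  exists c, forall j, a j = c * r j.
Proof.
move=> ra; have sumd (h : 'I_n -> k) j : \sum_l h l * (l == j)%:R = h j.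
  by rewrite (bigD1 j) //= eqxx mulr1 big1 ?addr0 // => l /negPf ->; rewrite mulr0.
have [[j0 rj0]|r0] := pselect (exists j, r j != 0); last first.
  exists 0 => j; rewrite mul0r -(sumd a j); apply: ra; rewrite sumd.
  by have [//|rj] := eqVneq (r j) 0; case: r0; exists j.
exists (a j0 / r j0) => j.
pose w l : k := (l == j)%:R - r j / r j0 * (l == j0)%:R.
have sumw (h : 'I_n -> k) : \sum_l h l * w l = h j - r j / r j0 * h j0.
  under eq_bigr => l _ do rewrite mulrBr mulrCA.
  by rewrite sumrB -mulr_sumr !sumd.
have := ra w; rewrite !sumw divfK // subrr => /(_ erefl) /eqP.
by rewrite subr_eq0 => /eqP ->; rewrite mulrAC [RHS]mulrAC [r j * _]mulrC.
Qed.

Variable beta : 'M[k]_n.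

Let bil a w : k := \sum_i \sum_j a i * beta i j * w j.
Let adm w : Prop := exists i, \sum_j beta i j * w j != 0.

Lemma bilE a w : bil a w = \sum_j (\sum_i a i * beta i j) * w j.
Proof.
by rewrite /bil exchange_big; apply: eq_bigr => j _; rewrite mulr_suml.
Qed.

(* Rank one, [beta i j = c i * r j], is the only obstruction to continuing a  *)
(* sequence greedily; then a constant sequence works unless the two factors   *)
(* are proportional.                                                          *)
Lemma point_or_square : beta != 0 ->
  (exists g : nat -> 'I_n -> k,
    [/\ forall j, g 0%N j = 0,
        forall D, \sum_i \sum_j g D i * beta i j * g D.+1 j = 0
      & forall D, exists i, \sum_j beta i j * g D.+1 j != 0]) \/
  (exists e (xi : 'I_n -> k) j0,
    [/\ e != 0, xi j0 != 0 & forall i j, beta i j = e * xi i * xi j]).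
Proof.
move=> b0.
have mkseq (h : ('I_n -> k) -> 'I_n -> k) v : adm v ->
    (forall w, adm w -> adm (h w) /\ bil w (h w) = 0) ->
    exists g : nat -> 'I_n -> k,
    [/\ forall j, g 0%N j = 0, forall D, bil (g D) (g D.+1) = 0
      & forall D, adm (g D.+1)].
  (* The zero functional at index 0 makes the first relation trivial; the iteration starts at index
     1. *)
  move=> av ah; exists (fun D => if D is E.+1 then iter E h v else fun=> 0).
  have ai E : adm (iter E h v) by elim: E => //= E /ah [].
  split=> // -[|D]; last exact: (ah _ (ai D)).2.
  by rewrite /bil big1 // => i _; rewrite big1 // => j _; rewrite !mul0r.
have [st|nst] := pselect (forall v, adm v -> exists w, adm w /\ bil v w = 0).
  left; have [i [j bij]] : exists i j, beta i j != 0.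
    have [//|no] := pselect (exists i j, beta i j != 0); case/eqP: b0; apply/matrixP => i j.
    by rewrite mxE; have [//|bij] := eqVneq (beta i j) 0; case: no; exists i, j.
  have /choice [h hh] v : exists w, adm v -> adm w /\ bil v w = 0.
    have [/st [w hw]|nv] := pselect (adm v); first by exists w.
    by exists v => /nv.
  apply: (mkseq h (fun l => (l == j)%:R)) => //; exists i.
  by rewrite (bigD1 j) //= eqxx mulr1 big1 ?addr0 // => l /negPf ->; rewrite mulr0.
have [v [av nv]] : exists v, adm v /\ forall w, bil v w = 0 -> ~ adm w.
  have [//|no] := pselect (exists v, adm v /\ forall w, bil v w = 0 -> ~ adm w).
  case: nst => v av; have [//|no'] := pselect (exists w, adm w /\ bil v w = 0).
  by case: no; exists v; split=> // w bw aw; apply: no'; exists w.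
pose r j := \sum_i v i * beta i j.
(* A vector killed by [r] is not admissible, so every row of [beta] kills it too and is therefore a
   multiple of [r]. *)
have /choice [c hc] i : exists c, forall j, beta i j = c * r j.
  apply: functional_factor => w rw; have := nv w; rewrite bilE rw => /(_ erefl) nw.
  by have [//|bw] := eqVneq (\sum_j beta i j * w j) 0; case: nw; exists i.
have betaw i w : \sum_j beta i j * w j = c i * \sum_j r j * w j.
  by rewrite mulr_sumr; apply: eq_bigr => j _; rewrite hc mulrA.
have [i ci0] : exists i, c i != 0.
  have [i] := av; rewrite betaw mulf_eq0 negb_or => /andP [ci _]; by exists i.
(* As [bil w w] is the product of the values of [c] and [r] at [w], a vector killed by [c] but not
   by [r] can be repeated forever. *)
have [[w [cw rw]]|no] := pselect (exists w, \sum_j c j * w j = 0 /\ \sum_j r j * w j != 0).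
  left; have aw : adm w by exists i; rewrite betaw mulf_neq0.
  have bw : bil w w = 0.
    rewrite /bil; under eq_bigr => l _.
      under eq_bigr => j _ do rewrite -mulrA.
      rewrite -mulr_sumr betaw mulrCA mulrA; over.
    by rewrite -mulr_suml cw mul0r.
  exists (fun D => if D is 0%N then fun=> 0 else w); split=> // -[|D] //.
  by rewrite big1 // => l _; rewrite big1 // => j _; rewrite !mul0r.
right; have [e he] : exists e, forall j, r j = e * c j.
  apply: functional_factor => w cw; have [//|rw] := eqVneq (\sum_j r j * w j) 0.
  by case: no; exists w.
have bE l j : beta l j = e * c l * c j by rewrite hc he mulrCA mulrA.
exists e, c, i; split=> //; apply: contraTneq b0 => e0; rewrite negbK; apply/eqP/matrixP => l j.
by rewrite bE e0 !mul0r mxE.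
Qed.

End Dichotomy.

(** * From generation in bounded degree to coherence *)

Section Coherence.
Variables (k : fieldType) (A : graded_algebra k).
Local Notation rmod m := {ffun 'I_m -> (A^c)^o}.

(** Scalars act as right multiplication by [c%:A]; this lets spans over [k] be compared with spans
    over [A^c]. *)
Lemma converse_lin_closed m (P : rmod m -> Prop) :
  lin_closed P -> lin_closed (M := {ffun 'I_m -> A}) P.
Proof.
move=> [P0 PD]; split=> // c x y Px Py; have := PD (c%:A : A) x y Px Py.
congr P; congr (_ + _); apply/ffunP => i; rewrite !ffunE.
by rewrite -[LHS]/(x i * c%:A) mulr_algr.
Qed.

Variables (n : nat) (X : 'I_n -> A) (beta : 'M[k]_n).
Hypothesis pres : one_relator_presentation X beta.

Lemma ga_gr_finite e : exists s : seq A, forall a, ga_gr e a -> lin_span (R := k) s a.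
Proof.
elim: e => [|e [s hs]].
  exists [:: 1] => a /ga_gr0P [c ->]; apply/lin_span_cons; exists c, 0.
  by rewrite addr0; split=> //; have [] := lin_span_closed ([::] : seq A).
exists [seq a * X j | a <- s, j <- enum 'I_n] => a /(orp_gen pres) [c [hc ->]].
apply: (lin_closed_sum _ (lin_span_closed _)) => j _.
have [sl0 slD] := lin_span_closed [seq a * X j | a <- s, j <- enum 'I_n].
move: (hs _ (hc j)); apply: (lin_span_min (P := fun y => lin_span _ (y * X j))).
  by split=> [|b x y hx hy]; rewrite ?mul0r // mulrDl -scalerAl; apply: slD.
move=> y ys; apply/lin_span_mem/allpairsP; exists (y, j).
by rewrite mem_enum.
Qed.

Variables (m : nat) (f : 'I_m -> A) (d : 'I_m -> nat).
Hypothesis f_gr : forall i, ga_gr (d i) (f i).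
Local Notation vec := {ffun 'I_m -> A}.

Let delta i (a : A) : vec := [ffun j => if j == i then a else 0].

Lemma vec_delta (c : vec) : c = \sum_i delta i (c i).
Proof.
apply/ffunP => i; rewrite sum_ffunE (bigD1 i) //= ffunE eqxx big1 ?addr0 // => j ji.
by rewrite ffunE eq_sym (negPf ji).
Qed.

Lemma hvec_finite (D : nat) :
  exists s : seq vec, forall c, hvec d D c -> lin_span (R := k) s c.
Proof.
have /choice [S hS] := ga_gr_finite.
exists [seq delta i a | i <- enum 'I_m, a <- flatten [seq S e | e <- iota 0 D.+1]] => c hc.
set T := [seq _ | _ <- _, _ <- _]; have [T0 TD] := lin_span_closed T.
rewrite [c]vec_delta; apply: (lin_closed_sum _ (lin_span_closed _)) => i _.
have delta0 : delta i 0 = 0 by apply/ffunP => j; rewrite !ffunE if_same.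
have := hc i; have [leD|ltD] := leqP (d i) D; last first.
  have -> : D%:Z - (d i)%:Z = Negz (d i - D).-1.
    by rewrite NegzE prednK ?subn_gt0 // -subzn ?opprB // ltnW.
  by move=> /= ->; rewrite delta0.
rewrite subzn // => /hS; apply: (lin_span_min (P := fun y => lin_span T (delta i y))).
  split=> [|b x y hx hy]; first by rewrite delta0.
  have -> : delta i (b *: x + y) = b *: delta i x + delta i y.
    by apply/ffunP => j; rewrite !ffunE; case: ifP; rewrite ?scaler0 ?addr0.
  exact: TD.
move=> y yS; apply/lin_span_mem/allpairsP; exists (i, y); rewrite mem_enum; split=> //.
apply/flatten_mapP; exists (D - d i)%N => //.
by rewrite mem_iota add0n ltnS leq_subr.
Qed.

(** Since [ev] preserves degrees, it sends the homogeneous components of [c] to those of [ev c = 0],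
    which vanish. *)
Lemma syzygy_homogeneous (c : vec) : ev f c = 0 ->
  exists N (s : nat -> vec), (forall D, (D < N)%N -> hsyz f d D%:Z (s D)) /\
    c = \sum_(D < N) s D.
Proof.
(* Asking for equality at every bound past [N0] lets decompositions of different lengths be
   added. *)
pose P (c : vec) := exists N0 (s : nat -> vec), (forall D, hvec d D%:Z (s D)) /\
  forall N, (N0 <= N)%N -> c = \sum_(D < N) s D.
have Pl : lin_closed P.
  split=> [|b x y [N [s [hs sN]]] [N' [s' [hs' sN']]]].
    exists 0%N, (fun=> 0); split=> [D|N _]; last by rewrite big1.
    by have [] := hvec_lin A d D.
  exists (maxn N N'), (fun D => b *: s D + s' D); split=> [D|M].
    by have [_] := hvec_lin A d D; apply.
  rewrite geq_max => /andP [/sN -> /sN' ->].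
  by rewrite scaler_sumr -big_split.
have : P c.
  rewrite [c]vec_delta; apply: (lin_closed_sum _ Pl) => i _.
  have [N [y [hy ->]]] := ga_gr_sum (c i).
  have -> : delta i (\sum_(e < N) y e) = \sum_(e < N) delta i (y e).
    by apply/ffunP => j; rewrite sum_ffunE ffunE; case: eqP => ji;
      [|rewrite big1 //]; try apply: eq_bigr; move=> e _; rewrite ffunE; case: eqP ji.
  apply: (lin_closed_sum _ Pl) => e _.
  exists (e + d i).+1, (fun D => if D == (e + d i)%N then delta i (y e) else 0).
  split=> [D|M ltM].
    case: eqP => [->|_]; last by have [] := hvec_lin A d D.
    move=> j; rewrite ffunE; case: eqP => [->|_]; first by rewrite PoszD addrK; apply: hy.
    by have [] := zgr_lin A ((e + d i)%N%:Z - (d j)%:Z).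
  rewrite (bigD1 (Ordinal ltM)) //= eqxx big1 ?addr0 // => D.
  by rewrite -val_eqE /= => /negPf ->.
move=> [N [s [hs /(_ _ (leqnn N)) cE]]] c0; exists N, s; split=> // D DN.
split; first exact: hs.
apply: (ga_gr_uniq (n := N) (y := fun D => ev f (s D))) DN => [E|].
  exact: (zgr_ev f_gr (hs E)).
by rewrite -[RHS]c0 cE ev_sum.
Qed.

(** Finite spanning lists of the [S_D] with [D <= D0] suffice: from [D0] on, [S_(D+1) = S_D V], and
    induction on the degree reaches the rest. *)
Lemma syzygy_finite :
    (exists D0, forall D s, (D0 <= D)%N -> hsyz f d D.+1%:Z s ->
      exists C : 'I_n -> vec, (forall j, hsyz f d D%:Z (C j)) /\
        s = \sum_j rmul (C j) (X j)) ->
  exists rs : seq (rmod m), (forall r, r \in rs -> exists D : nat, hsyz f d D%:Z r) /\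
    forall c : rmod m, ev f c = 0 -> lin_span rs c.
Proof.
move=> [D0 hD0].
have /choice [S hS] : forall D : nat, exists s : seq vec,
    (forall x, x \in s -> hsyz f d D x) /\ forall x, hsyz f d D x -> lin_span (R := k) s x.
  move=> D; have [s hs] := hvec_finite D.
  by apply: (lin_span_subspace (hsyz_lin f d D) (s := s)) => x [hx _]; apply: hs.
pose rs : seq (rmod m) := flatten [seq S D | D <- iota 0 D0.+1].
have rsl : lin_closed (lin_span rs) := lin_span_closed rs.
exists rs; split=> [r /flatten_mapP [D _ /(hS D).1]|c]; first by exists D.
move=> /syzygy_homogeneous [N [s [hs ->]]].
apply: (lin_closed_sum _ rsl) => -[D DN] _ /=; have {DN} := hs D DN.
elim: D {hs} (s D) => [|D IH] x hx.
  apply: (lin_span_min (converse_lin_closed rsl)) ((hS 0%N).2 x hx) => y yS.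
  by apply: lin_span_mem; apply/flatten_mapP; exists 0%N.
have [leD|ltD] := leqP D0 D; last first.
  apply: (lin_span_min (converse_lin_closed rsl)) ((hS D.+1).2 x hx) => y yS.
  by apply: lin_span_mem; apply/flatten_mapP; exists D.+1; rewrite // mem_iota add0n ltnS.
have [C [hC ->]] := hD0 D x leD hx.
apply: (lin_closed_sum _ rsl) => j _.
have -> : rmul (C j) (X j) = (X j : A^c) *: (C j : rmod m).
  by apply/ffunP => i; rewrite !ffunE.
by apply: (lin_closedZ _ rsl); apply: IH.
Qed.

End Coherence.

(** * Homogeneous generators of a graded right ideal *)

Section HomogeneousGenerators.
Variables (k : fieldType) (A : graded_algebra k).

Lemma fin_generated_homogeneous (I : regular_right A -> Prop) :
    graded_sub (M := regular_right A) (@zgr k A) I -> fin_generated I ->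
  exists m (g : 'I_m -> A) (d : 'I_m -> nat), (forall i, ga_gr (d i) (g i)) /\
    spans (M := regular_right A) g I.
Proof.
move=> Igr [m [g gI]].
have Il : lin_closed I.
  split=> [|c x y /gI [u ->] /gI [v ->]]; apply/gI.
    by exists (fun=> 0); rewrite big1 // => i _; rewrite scale0r.
  exists (fun i => c * u i + v i); rewrite scaler_sumr -big_split.
  by apply: eq_bigr => i _; rewrite scalerDl scalerA.
have /choice [S hS] i : exists s : seq (regular_right A),
    (forall x, x \in s -> I x /\ exists d, ga_gr d (x : A)) /\ lin_span s (g i).
  have /Igr [p [e [y [hy ->]]]] : I (g i).
    apply/gI; exists (fun j => (j == i)%:R); rewrite (bigD1 i) //= eqxx scale1r.
    by rewrite big1 ?addr0 // => j /negPf ->; rewrite scale0r.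
  exists [seq y l | l <- enum 'I_p]; split=> [x /mapP [l _ ->]|].
    split; first exact: (hy l).2.
    have := (hy l).1; case: (e l) => [D|D] /= hD; first by exists D.
    (* A component of negative degree is zero and may be given degree 0. *)
    by exists 0%N; rewrite hD; have [] := ga_gr_lin A 0.
  apply: (lin_closed_sum _ (lin_span_closed _)) => l _.
  by apply/lin_span_mem/map_f; rewrite mem_enum.
pose s := flatten [seq S i | i <- enum 'I_m].
have sE x : x \in s -> I x /\ exists d, ga_gr d (x : A).
  by move=> /flatten_mapP [i _ /(hS i).1].
have /choice [d hd] (x : A) : exists d, x \in s -> ga_gr d x.
  by have [/sE [_ [d hd]]|xs] := boolP (x \in s); [exists d | exists 0%N].
exists (size s), (fun i => s`_i), (fun i => d s`_i); split=> [i|x].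
  by apply: hd; apply: mem_nth.
split=> [/gI [c ->]|].
  apply: (lin_closed_sum _ (lin_span_closed s)) => i _.
  apply: (lin_closedZ _ (lin_span_closed s)).
  apply: lin_span_sub (hS i).2 => y yS; apply/flatten_mapP.
  by exists i; rewrite // mem_enum.
by move=> hx; apply: (lin_span_min Il) (hx : lin_span s x) => y /sE [].
Qed.

End HomogeneousGenerators.

(** The last hypothesis asks that sequences satisfying the relation define functionals on [A] as a
    point module does. Either alternative of [point_or_square] then bounds the degrees of generating
    syzygies. *)
Lemma one_relator_coherent (k : fieldType) (A : graded_algebra k) n (X : 'I_n -> A)
    (beta : 'M[k]_n) : one_relator_presentation X beta -> beta != 0 ->
    (forall g : nat -> 'I_n -> k, (forall j, g 0%N j = 0) ->
      (forall D, \sum_i \sum_j g D i * beta i j * g D.+1 j = 0) ->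
      exists eps : nat -> A -> k,
        [/\ forall D (e : k) x y, eps D (e *: x + y) = e * eps D x + eps D y,
            forall D, eps D 1 = 1
          & forall D a j, eps D (a * X j) = g D j * eps D.-1 a]) ->
  graded_coherent A.
Proof.
move=> pres b0 point I /fin_generated_homogeneous h /h [m [f [d [f_gr fI]]]].
have [rs [rsE rsP]] : exists rs : seq {ffun 'I_m -> (A^c)^o},
    (forall r, r \in rs -> exists D : nat, hsyz f d D%:Z r) /\
    forall c : {ffun 'I_m -> (A^c)^o}, ev f c = 0 -> lin_span rs c.
  apply: (syzygy_finite pres f_gr).
  have [[g [g0 g_rel g_supp]]|[e [xi [j0 [e0 xi0 bE]]]]] := point_or_square b0.
    have [eps [epsP eps1 epsX]] := point g g0 g_rel.
    exact: (hsyz_gen_point pres f_gr g_rel g_supp epsP eps1 epsX).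
  exact: (hsyz_gen_square pres f_gr e0 xi0 bE).
have /choice [D hD] (r : {ffun 'I_m -> (A^c)^o}) :
    exists D : nat, r \in rs -> hsyz f d D%:Z r.
  by have [/rsE [D hD]|rrs] := boolP (r \in rs); [exists D | exists 0%N].
exists m, f, (fun i => (d i)%:Z), (size rs), (fun j => rs`_j), (fun j => (D rs`_j)%:Z).
split=> //.
  by move=> j i; apply: (hD _ (mem_nth _ _)).1.
move=> c; split=> [/rsP //|hc].
suff [] : lin_closed (syzygy (M := regular_right A) f) /\
    forall r, r \in rs -> syzygy (M := regular_right A) f r.
  by move=> l hr; apply: (lin_span_min l hr hc).
split; last by move=> r /rsE [? []].
split=> [|a x y hx hy]; rewrite /syzygy.
  by rewrite big1 // => i _; rewrite ffunE scale0r.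
under eq_bigr => i _ do rewrite !ffunE scalerDl -scalerA.
by rewrite big_split /= -scaler_sumr hx hy scaler0 addr0.
Qed.

Lemma lin_closed_eq (k : fieldType) (U : lmodType k) (h1 h2 : U -> k) :
  (forall c x y, h1 (c *: x + y) = c * h1 x + h1 y) ->
  (forall c x y, h2 (c *: x + y) = c * h2 x + h2 y) ->
  lin_closed (fun x => h1 x = h2 x).
Proof.
move=> hP1 hP2; split=> [|c x y e1 e2]; first by rewrite !functional0.
by rewrite hP1 hP2 e1 e2.
Qed.

(** * Splitting off right factors, and the two-sided ideal of a relation *)

Section RightDecomposition.
Variables (k : fieldType) (U : algType k) (n : nat) (X : 'I_n -> U).

Lemma eq_lin_sum (c d : 'I_n -> k) :
  (forall i, c i = d i) -> \sum_i c i *: X i = \sum_i d i *: X i.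
Proof. by move=> cd; apply: eq_bigr => i _; rewrite cd. Qed.

Lemma eq_quad_sum (y z : 'I_n -> U) :
  (forall i, y i = z i) -> \sum_i y i * X i = \sum_i z i * X i.
Proof. by move=> yz; apply: eq_bigr => i _; rewrite yz. Qed.

Lemma lin_closed_annihilator (J : Type) (h : J -> U -> k) (w : U) :
  (forall D c x y, h D (c *: x + y) = c * h D x + h D y) ->
  lin_closed (fun v => forall D, h D (w * v) = 0).
Proof.
move=> hP; split=> [D|c x y hx hy D]; last first.
  by rewrite mulrDr -scalerAr hP hx hy mulr0 addr0.
by rewrite mulr0; apply: functional0.
Qed.

(** Each functional strips one right factor and hands the rest to the next, so two steps turn the
    relation into the scalar [beta (g1, g)]. *)
Lemma functional_quad (beta : 'M[k]_n) (u : U) (h h1 h2 : U -> k) (g g1 : 'I_n -> k) :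
  (forall c x y, h (c *: x + y) = c * h x + h y) ->
  (forall c x y, h1 (c *: x + y) = c * h1 x + h1 y) ->
  (forall x j, h (x * X j) = g j * h1 x) ->
  (forall x j, h1 (x * X j) = g1 j * h2 x) ->
  h (u * (\sum_j (\sum_i beta i j *: X i) * X j)) =
    (\sum_i \sum_j g1 i * beta i j * g j) * h2 u.
Proof.
move=> hP h1P hX h1X.
rewrite mulr_sumr (big_morph h (functionalD hP) (functional0 hP)) exchange_big mulr_suml.
apply: eq_bigr => j _; rewrite mulrA hX mulr_sumr.
rewrite (big_morph h1 (functionalD h1P) (functional0 h1P)) mulr_sumr mulr_suml.
apply: eq_bigr => i _; rewrite -scalerAr -[_ *: _]addr0 h1P functional0 // addr0 h1X.
by rewrite !mulrA; congr (_ * _); rewrite mulrC [g j * _]mulrC mulrA.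
Qed.

Lemma quad_decomp (q : U) (y z : 'I_n -> U) :
  q * (\sum_j y j * X j) + \sum_j z j * X j = \sum_j (q * y j + z j) * X j.
Proof.
rewrite mulr_sumr -big_split; apply: eq_bigr => j _.
by rewrite mulrDl mulrA.
Qed.

Definition right_decomp (x : U) : Prop :=
  exists (c : k) (y : 'I_n -> U), x = c%:A + \sum_j y j * X j.

Lemma right_decomp_closed : lin_closed right_decomp.
Proof.
split=> [|c x y [d [u ->]] [e [v ->]]].
  by exists 0, (fun=> 0); rewrite scale0r add0r big1 // => j _; rewrite mul0r.
exists (c * d + e), (fun j => c *: u j + v j).
rewrite scalerDr scalerA scalerDl addrACA scaler_sumr -big_split.
by congr (_ + _); apply: eq_bigr => j _; rewrite mulrDl scalerAl.
Qed.

Lemma right_decomp1 : right_decomp 1.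
Proof.
by exists 1, (fun=> 0); rewrite scale1r big1 ?addr0 // => j _; rewrite mul0r.
Qed.

Lemma right_decomp_mul x i : right_decomp (x * X i).
Proof.
exists 0, (fun j => if j == i then x else 0).
rewrite scale0r add0r (bigD1 i) //= eqxx big1 ?addr0 // => j /negPf ->.
by rewrite mul0r.
Qed.

(** Splitting the right factors in [u b v] into scalars and multiples of the [X j] collects the
    scalars in [q] and leaves members of the ideal in front of the [X j]. *)
Lemma ideal_gen_decomp (b x : U) : (forall y, right_decomp y) -> ideal_gen b x ->
  exists q (z : 'I_n -> U),
    (forall j, ideal_gen b (z j)) /\ x = q * b + \sum_j z j * X j.
Proof.
move=> dec [m [u [v ->]]].
have /choice [c /choice [y hy]] i := dec (v i).
have ideal_mul p q : ideal_gen b (p * b * q).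
  by exists 1%N, (fun=> p), (fun=> q); rewrite big_ord1.
exists (\sum_i c i *: u i), (fun j => \sum_i u i * b * y i j); split=> [j|].
  by apply: ideal_gen_sum => i _; apply: ideal_mul.
under [X in _ + X]eq_bigr => j _ do rewrite mulr_suml.
rewrite exchange_big mulr_suml -big_split; apply: eq_bigr => i _ /=.
rewrite {1}hy mulrDr mulr_algr scalerAl mulr_sumr; congr (_ + _).
by apply: eq_bigr => j _; rewrite mulrA.
Qed.

End RightDecomposition.

(** * The quotient of the tensor algebra *)

Lemma sum_pick (J : finType) (U W : zmodType) (h : U -> W) (F : J -> U) j w :
  {morph h : x y / x + y} -> h 0 = 0 -> h (F j) = w ->
  (forall i, i != j -> h (F i) = 0) -> h (\sum_i F i) = w.
Proof.
by move=> hD h0 <- hF; rewrite (big_morph h hD h0) (bigD1 j) //= big1 ?addr0.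
Qed.

Section TensorAlgebraDivision.
Variables (k : fieldType) (V : vectType k).
Local Notation I := 'I_(\dim {:V}).
Local Notation T := (tensor_alg V).
Implicit Types (x y : T) (s : seq I).

Definition word s : T := << FMonom s >>.

Lemma word_nil : word [::] = 1.
Proof. by rewrite /word tensor_word big_nil. Qed.

Lemma word_rcons s i : word (rcons s i) = word s * tensor_var i.
Proof. by rewrite /word !tensor_word -cats1 big_cat big_seq1. Qed.

Lemma word_span (P : T -> Prop) : lin_closed P -> (forall s, P (word s)) -> forall x, P x.
Proof.
move=> Pl Pw x; rewrite [x]monalgE; apply: (lin_closed_sum _ Pl) => -[s] _.
have -> : << x@_(FMonom s) *g FMonom s >> = x@_(FMonom s) *: word s :> T.
  by rewrite -mul_malgC malgM_def fgmulUU mulr1 mul1m.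
exact: (lin_closedZ _ Pl).
Qed.

(* Words are handed to [h] reversed, because right multiplication by a        *)
(* generator acts on the last letter.                                         *)
Definition word_lift (U : algType k) (h : seq I -> U) : T -> U :=
  mmap (in_alg U) (fun m : {fmonom I} => h (rev m)).

Lemma word_liftP (U : algType k) (h : seq I -> U) (c : k) x y :
  word_lift h (c *: x + y) = c *: word_lift h x + word_lift h y.
Proof.
rewrite /word_lift mmapD; congr (_ + _).
rewrite (mmapEw (msuppZ_le _ _)) mmapE scaler_sumr; apply: eq_bigr => m _.
by rewrite mcoeffZ /= -scalerA -scalerAl.
Qed.

Lemma word_lift_word (U : algType k) (h : seq I -> U) s : word_lift h (word s) = h (rev s).
Proof. by rewrite /word_lift mmapU /= scale1r mul1r. Qed.

Lemma word_lift0 (U : algType k) (h : seq I -> U) : word_lift h 0 = 0.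
Proof. exact: mmap0. Qed.

Definition rdiv j : T -> T :=
  word_lift (fun s => if s is i :: s' then if i == j then word (rev s') else 0 else 0).

Lemma rdivP j (c : k) x y : rdiv j (c *: x + y) = c *: rdiv j x + rdiv j y.
Proof. exact: word_liftP. Qed.

Lemma rdiv0 j : rdiv j 0 = 0.
Proof. exact: word_lift0. Qed.

Lemma rdiv_var j i x : rdiv j (x * tensor_var i) = if i == j then x else 0.
Proof.
elim/word_span: x => [|s].
  split=> [|c x y hx hy]; first by rewrite mul0r rdiv0 if_same.
  rewrite mulrDl -scalerAl !rdivP hx hy.
  by case: ifP; rewrite ?scaler0 ?addr0.
by rewrite -word_rcons /rdiv word_lift_word rev_rcons revK.
Qed.

(** Left coefficients along the variables are therefore unique, which allows the comparison of
    coefficients in [one_relator_exact]. *)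
Lemma rdiv_decomp j (y : I -> T) : rdiv j (\sum_i y i * tensor_var i) = y j.
Proof.
apply: (sum_pick (j := j)) => [x z|||i ij].
- by rewrite -[x]scale1r rdivP !scale1r.
- exact: rdiv0.
- by have := rdiv_var j j (y j); rewrite eqxx.
by have := rdiv_var j i (y i); rewrite (negPf ij).
Qed.

Lemma tensor_decomp x : right_decomp (@tensor_var k V) x.
Proof.
elim/word_span: x => [|s]; first exact: right_decomp_closed.
case/lastP: s => [|s i]; first by rewrite word_nil; apply: right_decomp1.
by rewrite word_rcons; apply: right_decomp_mul.
Qed.

Lemma tensor_proj_mul1 d y x : tensor_gr 1 x ->
  tensor_proj d.+1 (y * x) = tensor_proj d y * x.
Proof.
move=> hx; have [n yE] := tensor_proj_sum y.
rewrite {1}yE mulr_suml raddf_sum {2}yE raddf_sum mulr_suml; apply: eq_bigr => e _ /=.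
have he : tensor_gr (e + 1) (tensor_proj e y * x).
  by apply: tensor_grM hx; apply: tensor_proj_gr.
rewrite (tensor_proj_id d.+1 he) (tensor_proj_id d (@tensor_proj_gr _ _ e y)) addn1 eqSS.
by case: ifP; rewrite ?mul0r.
Qed.

Lemma tensor_proj0_mul1 y x : tensor_gr 1 x -> tensor_proj 0 (y * x) = 0.
Proof.
move=> hx; have [n yE] := tensor_proj_sum y.
rewrite yE mulr_suml raddf_sum big1 // => e _ /=.
rewrite (tensor_proj_id 0 (e := (e + 1)%N)) ?addn1 //.
by rewrite -addn1; apply: tensor_grM hx; apply: tensor_proj_gr.
Qed.

Lemma tensor_gr_var i : tensor_gr 1 (tensor_var i : T).
Proof. by rewrite -tensor_inj_basis; apply: tensor_gr_inj. Qed.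

Lemma tensor_gr_decomp d x : tensor_gr d.+1 x ->
  exists y : I -> T, (forall j, tensor_gr d (y j)) /\ x = \sum_j y j * tensor_var j.
Proof.
move=> hx; have [c [y xE]] := tensor_decomp x.
exists (fun j => tensor_proj d (y j)); split=> [j|]; first exact: tensor_proj_gr.
have <- : tensor_proj d.+1 x = x by rewrite (tensor_proj_id _ hx) eqxx.
have c0 : tensor_gr 0 (c%:A : T) by apply/tensor_gr0; exists c.
rewrite xE raddfD /= (tensor_proj_id _ c0) add0r raddf_sum; apply: eq_bigr => j _.
by rewrite /= (tensor_proj_mul1 d (y j) (@tensor_gr_var j)).
Qed.

Lemma tensor_gr2_matrix b : tensor_gr 2 b -> exists beta : 'M[k]_(\dim {:V}),
  b = \sum_j (\sum_i beta i j *: tensor_var i) * tensor_var j.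
Proof.
move=> /tensor_gr_decomp [y [hy ->]].
have /choice [z hz] j : exists z : I -> k, y j = \sum_i z i *: tensor_var i.
  have [w [hw ->]] := tensor_gr_decomp (hy j).
  have /choice [z hz] i : exists c : k, w i = c%:A by apply/tensor_gr0/hw.
  by exists z; apply: eq_bigr => i _; rewrite hz mulr_algl.
exists (\matrix_(i, j) z j i); apply: eq_quad_sum => j; rewrite hz.
by apply: eq_lin_sum => i; rewrite mxE.
Qed.

End TensorAlgebraDivision.

(** * Point modules over the free algebra *)

Section PointFunctionals.
Variables (k : fieldType) (V : vectType k).
Local Notation I := 'I_(\dim {:V}).
Local Notation T := (tensor_alg V).
Variable (g : nat -> I -> k).

(* The truncation of [D.-1] at [D = 0] is harmless, since [g 0 = 0] below. *)
Fixpoint weight D (s : seq I) : k :=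
  if s is i :: s' then g D i * weight D.-1 s' else 1.

(** On a word of length [l <= D] this is the coefficient of [p_D] in [p_(D-l)] times the word. *)
Definition point_eval D : T -> k := word_lift (U := k^o) (weight D).

Lemma point_evalP D (c : k) (x y : T) :
  point_eval D (c *: x + y) = c * point_eval D x + point_eval D y.
Proof. exact: (word_liftP (U := k^o) (weight D)). Qed.

Lemma point_eval1 D : point_eval D 1 = 1.
Proof. by rewrite -word_nil /point_eval word_lift_word. Qed.

Lemma point_eval0 D : point_eval D 0 = 0.
Proof. exact: (word_lift0 (U := k^o)). Qed.

Lemma point_eval_sum D (J : Type) (r : seq J) (F : J -> T) :
  point_eval D (\sum_(l <- r) F l) = \sum_(l <- r) point_eval D (F l).
Proof.
apply: (big_morph (point_eval D)) => [x y|]; last exact: point_eval0.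
by rewrite -[x]scale1r point_evalP mul1r scale1r.
Qed.

Lemma point_eval_var D (x : T) i :
  point_eval D (x * tensor_var i) = g D i * point_eval D.-1 x.
Proof.
elim/word_span: x => [|s]; last first.
  by rewrite -word_rcons /point_eval !word_lift_word rev_rcons.
apply: lin_closed_eq => c x y; first by rewrite mulrDl -scalerAl point_evalP.
by rewrite point_evalP mulrDr mulrCA.
Qed.

Variable beta : 'M[k]_(\dim {:V}).
Hypothesis g0 : forall j, g 0%N j = 0.
Hypothesis g_rel : forall D, \sum_i \sum_j g D i * beta i j * g D.+1 j = 0.

(** The letters of the right factor are stripped one by one, each lowering the index; then
    [functional_quad] produces [beta (g_(D-1), g_D)], zero by [g_rel], or by [g0] at index 0. *)
Lemma point_eval_ideal D (x : T) :
  ideal_gen (\sum_j (\sum_i beta i j *: tensor_var i) * tensor_var j) x ->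
  point_eval D x = 0.
Proof.
set b := \sum_j _; move=> [n [u [v ->]]]; rewrite point_eval_sum big1 // => l _.
elim/word_span: (v l) D => [|s]; first exact: (lin_closed_annihilator _ point_evalP).
elim/last_ind: s => [|s i IH] D; last by rewrite word_rcons mulrA point_eval_var IH mulr0.
rewrite word_nil mulr1.
rewrite (functional_quad beta (u l) (point_evalP D) (point_evalP D.-1)
  (fun y j => point_eval_var D y j) (fun y j => point_eval_var D.-1 y j)).
case: D => [|D]; last by rewrite /= g_rel mul0r.
by rewrite big1 ?mul0r // => i _; rewrite big1 // => j _; rewrite g0 mulr0.
Qed.

End PointFunctionals.

(** * Presentation and point functionals of the quotient *)

Section OneRelator.
Variables (k : fieldType) (V : vectType k) (b : tensor_alg V).
Variable (b_quad : tensor_gr 2 b).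
Local Notation I := 'I_(\dim {:V}).
Local Notation T := (tensor_alg V).
Local Notation A := (one_relator_alg b_quad).
Local Notation proper := (ideal_gen_proper (ltn0Sn 1) b_quad).
Local Notation Q := (alg_quot proper).
Local Notation pi := (alg_quot_pi proper).

Variable beta : 'M[k]_(\dim {:V}).
Hypothesis bE : b = \sum_j (\sum_i beta i j *: tensor_var i) * tensor_var j.

Let X (j : I) : Q := pi (tensor_var j).

Lemma tensor_gr_lin d : lin_closed (M := T) (@tensor_gr k V d).
Proof.
split=> [m|c x y]; last exact: tensor_grP.
by rewrite mcoeff0 eqxx.
Qed.

Lemma pi_lin_comb (c : I -> k) : pi (\sum_i c i *: tensor_var i) = \sum_i c i *: X i.
Proof. by rewrite raddf_sum; apply: eq_bigr => i _; rewrite /= linearZ. Qed.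

Lemma pi_right_comb (y : I -> T) : pi (\sum_j y j * tensor_var j) = \sum_j pi (y j) * X j.
Proof. by rewrite raddf_sum; apply: eq_bigr => i _; rewrite /= rmorphM. Qed.

Lemma ideal_gen_pi0 x : ideal_gen b x <-> pi x = 0.
Proof.
rewrite -[X in ideal_gen b X]subr0 -(alg_quot_piP proper x 0).
by rewrite (raddf0 pi).
Qed.

(** Lift the relation to [T], where [ideal_gen_decomp] applies. Comparing coefficients of the
    variables gives [al j = q * R j + z j] with [z j] in the ideal; it remains to project to degree
    [d] and pass to the quotient. *)
Lemma one_relator_exact d (a : I -> Q) : (forall j, one_relator_gr d (a j)) ->
  \sum_j a j * X j = 0 ->
  exists q, (if d is e.+1 then one_relator_gr e q else q = 0) /\
    forall j, a j = q * \sum_i beta i j *: X i.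
Proof.
move=> /choice [al hal] a0.
have aE j : a j = pi (al j) := (hal j).2.
have : ideal_gen b (\sum_j al j * tensor_var j).
  apply/ideal_gen_pi0; rewrite pi_right_comb -[RHS]a0.
  by apply: eq_bigr => j _; rewrite aE.
move=> /(ideal_gen_decomp (@tensor_decomp _ V)) [q [z [hz E]]].
pose R j : T := \sum_i beta i j *: tensor_var i.
have R1 j : tensor_gr 1 (R j).
  by apply: (lin_closed_sum _ (tensor_gr_lin 1)) => i _;
    apply: (lin_closedZ _ (tensor_gr_lin 1)); apply: tensor_gr_var.
have alE j : al j = q * R j + z j.
  have E0 : q * b + \sum_j z j * tensor_var j =
      q * (\sum_j R j * tensor_var j) + \sum_j z j * tensor_var j.
    exact: (congr1 (fun b' => q * b' + \sum_j z j * tensor_var j) bE).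
  have E1 := etrans E0 (quad_decomp (@tensor_var k V) q R z).
  have E2 := congr1 (rdiv j) (etrans E E1).
  exact: etrans (esym (rdiv_decomp j al)) (etrans E2 (rdiv_decomp j _)).
have projE j : al j = tensor_proj d (q * R j) + tensor_proj d (z j).
  by rewrite -raddfD -alE /= (tensor_proj_id d (hal j).1) eqxx.
have piz j : pi (tensor_proj d (z j)) = 0.
  by apply/ideal_gen_pi0; apply: (ideal_gen_proj _ b_quad).
have aE' j : a j = pi (tensor_proj d (q * R j)).
  by rewrite aE projE raddfD [X in _ + X]piz addr0.
(* A right multiple of [R j] has no component of degree 0, so [q = 0] serves there. *)
case: d {hal projE piz} aE' => [|d] aE'.
  exists 0; split=> // j.
  by rewrite aE' (tensor_proj0_mul1 q (R1 j)) raddf0 mul0r.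
exists (pi (tensor_proj d q)); split=> [|j].
  by exists (tensor_proj d q); split=> //; apply: tensor_proj_gr.
by rewrite aE' (tensor_proj_mul1 d q (R1 j)) rmorphM; congr (_ * _); apply: pi_lin_comb.
Qed.

Lemma one_relator_alg_presentation : one_relator_presentation (A := A) X beta.
Proof.
split.
- move=> d a [x [/tensor_gr_decomp [y [hy ->]] ->]].
  exists (fun j => pi (y j)); split; last exact: pi_right_comb.
  by move=> j; exists (y j).
- by move=> j; exists (tensor_var j); split=> //; apply: tensor_gr_var.
- have pib : pi b = 0.
    by apply/ideal_gen_pi0; exists 1%N, (fun=> 1), (fun=> 1); rewrite big_ord1 mul1r mulr1.
  apply: etrans (etrans (esym (congr1 pi bE)) pib).
  by rewrite pi_right_comb; apply: eq_bigr => j _; congr (_ * _); rewrite pi_lin_comb.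
move=> z a ha a0; case: z ha => [d|d] ha.
  have [q [hq qE]] := one_relator_exact ha a0; exists q; split=> //.
  by case: d hq {ha} => [|d] //; rewrite subz1_succ.
exists 0; split=> [|j]; first by have [] := zgr_lin A (Negz d - 1).
by rewrite mul0r; apply: ha.
Qed.

(** The functionals on [T] vanish on the ideal, so their values do not depend on the
    representative. *)
Lemma one_relator_alg_point (g : nat -> I -> k) : (forall j, g 0%N j = 0) ->
  (forall D, \sum_i \sum_j g D i * beta i j * g D.+1 j = 0) ->
  exists eps : nat -> A -> k,
    [/\ forall D (e : k) x y, eps D (e *: x + y) = e * eps D x + eps D y,
        forall D, eps D 1 = 1
      & forall D a j, eps D (a * X j) = g D j * eps D.-1 a].
Proof.
move=> g0 g_rel; pose eps D (a : Q) := point_eval g D (alg_quot_repr a).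
have epsE D x : eps D (pi x) = point_eval g D x.
  have : ideal_gen b (alg_quot_repr (pi x) - x).
    by apply/(alg_quot_piP proper); rewrite alg_quot_reprK.
  rewrite {1}bE => /(point_eval_ideal g0 g_rel D).
  by rewrite -scaleN1r addrC point_evalP mulN1r addrC => /eqP; rewrite subr_eq0 => /eqP.
exists eps; split=> [D e x y|D|D a j].
- rewrite -[x]alg_quot_reprK -[y]alg_quot_reprK.
  rewrite -[_ + _](linearP pi) !epsE.
  exact: point_evalP.
- by rewrite -(rmorph1 pi) epsE; apply: point_eval1.
- rewrite -[a]alg_quot_reprK -[_ * X j](rmorphM pi) !epsE.
  exact: point_eval_var.
Qed.

End OneRelator.

Unset Implicit Arguments.

Theorem theorem1p2 (k : fieldType) (V : vectType k) (b : tensor_alg V)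
    (b_quad : tensor_gr 2 b) (b_neq0 : b != 0) :
  graded_coherent (one_relator_alg b_quad).
Proof.
have [beta bE] := tensor_gr2_matrix b_quad.
apply: (one_relator_coherent (one_relator_alg_presentation b_quad bE)).
  apply: contraNneq b_neq0 => beta0; rewrite bE; apply/eqP/big1 => j _.
  by rewrite big1 ?mul0r // => i _; rewrite beta0 mxE scale0r.
exact: one_relator_alg_point.
Qed.
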